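(* Let $\mathcal{A}$ be a non-empty subset of $\mathbb{N}=\{1,2,3,\dots\}$ with $\mathcal{A}\neq\{1\}$. For every $n\ge 1$ for which there exist non-crossing partitions of $[n]=\{1,\dots,n\}$ all of whose block sizes belong to $\mathcal{A}$, let $P^{\mathcal{A}}_n$ be a random non-crossing partition chosen uniformly at random among all of these. Let $\pi_{\mathcal{A}}$ be the probability measure on $\mathbb{Z}_+=\{0,1,2,\dots\}$ defined by $$\pi_{\mathcal{A}}(k)=\frac{\xi_{\mathcal{A}}^{k}}{1+\sum_{i\in\mathcal{A}}\xi_{\mathcal{A}}^{i}}\,\mathbf{1}_{k\in\{0\}\cup\mathcal{A}},\qquad\text{where }\xi_{\mathcal{A}}>0\text{ is such that}\qquad 1+\sum_{i\in\mathcal{A}}\xi_{\mathcal{A}}^{i}=\sum_{i\in\mathcal{A}} i\cdot\xi_{\mathcal{A}}^{i}.$$ Below, $n\to\infty$ along the values for which $P^{\mathcal{A}}_n$ is defined. (i) Let $S_1(P^{\mathcal{A}}_n)$ be the size of the block containing $1$ in $P^{\mathcal{A}}_n$. Then for every $k\ge1$, $\mathbb{P}(S_1(P^{\mathcal{A}}_n)=k)\to k\,\pi_{\mathcal{A}}(k)$ as $n\to\infty$. (ii) Let $B_n$ be a block chosen uniformly at random in $P^{\mathcal{A}}_n$. Then for every $k\ge1$, $\mathbb{P}(|B_n|=k)\to \pi_{\mathcal{A}}(k)/(1-\pi_{\mathcal{A}}(0))$ as $n\to\infty$. (iii) Let $C$ be a non-empty subset of $\mathbb{N}$ and denote by $\zeta_C(P^{\mathcal{A}}_n)$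 the number of blocks of $P^{\mathcal{A}}_n$ whose size belongs to $C$. As $n\to\infty$, the convergence $\zeta_C(P^{\mathcal{A}}_n)/n\to\pi_{\mathcal{A}}(C)$ holds in probability and, in addition, $\mathbb{E}[\zeta_C(P^{\mathcal{A}}_n)]/n\to\pi_{\mathcal{A}}(C)$.
   Context: A partition of $[n]=\{1,\dots,n\}$ is a collection of pairwise disjoint non-empty subsets (blocks) with union $[n]$. It is non-crossing if, when $1,\dots,n$ are placed in clockwise order at the vertices of a regular $n$-gon, the convex hulls of its blocks are pairwise disjoint. The number $\xi_{\mathcal{A}}$ is understood to be such that the series involved converge. *)

(* Defs.v *)
From HB Require Import structures.
From mathcomp Require Import all_boot all_order all_algebra.
From mathcomp Require Import all_classical all_reals all_analysis.
Set Implicit Arguments.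
Unset Strict Implicit.
Unset Printing Implicit Defensive.
Import Order.TTheory GRing.Theory Num.Theory.
Import numFieldNormedType.Exports.
Local Open Scope classical_set_scope.
Local Open Scope ring_scope.

Section uniform.
Context (R : realType) (T : finType).
Implicit Types S : {set T}.

Definition unif_mean S (X : T -> R) : R := (\sum_(x in S) X x) / #|S|%:R.

Definition unif_prob S (E : pred T) : R :=
  #|[set x in S | E x]%SET|%:R / #|S|%:R.

End uniform.

(* The label i in {1, ..., n} is represented by the ordinal i - 1 : 'I_n. *)
Section partitions.
Context (R : realType).

(* The points of 'I_n are placed clockwise on the unit circle, at the vertices
   of a regular n-gon. *)
Definition vertex n (i : 'I_n) : R^o * R^o :=
  let t := 2 * pi * i%:R / n%:R in (cos t, - sin t).

Definition conv_hull (E : set (R^o * R^o)) : set (R^o * R^o) :=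
  smallest (@convex_set R (R^o * R^o)%type) E.

Definition noncrossing n (P : {set {set 'I_n}}) : Prop :=
  classical_sets.trivIset [set` P]
    (fun B : {set 'I_n} => conv_hull (@vertex n @` [set` B])).

Definition NC (A : set nat) n : {set {set {set 'I_n}}} :=
  [set P : {set {set 'I_n}} | [&& finset.partition P [set: 'I_n]%SET,
    `[< noncrossing P >] & [forall B in P, #|B| \in A]]]%SET.

(* n --> +oo along the n >= 1 for which NC A n is non-empty *)
Definition along (A : set nat) : set_system nat :=
  within [set n | (0 < n)%N /\ exists P, P \in NC A n] \oo.

End partitions.

(* Size of the block containing the label 1; the value for n = 0 is junk. *)
Definition first_block_size n : {set {set 'I_n}} -> nat :=
  match n with
  | 0 => fun=> 0
  | m.+1 => fun P => #|finset.pblock P (ord0 : 'I_m.+1)|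
  end.

Definition zeta (C : set nat) n (P : {set {set 'I_n}}) : nat :=
  #|[set B in P | #|B| \in C]%SET|.

Section weights.
Context (R : realType).

(* Partial sums of \sum_(i in A) f i, in increasing order of i; the terms of
   the sums below are nonnegative, so that the order does not matter. *)
Definition partial_sums (A : set nat) (f : nat -> R) : nat -> R :=
  series (fun i => \1_A i * f i).

Definition sum_over (A : set nat) (f : nat -> R) : R :=
  limn (partial_sums A f).

Definition pi_pmf (A : set nat) (xi : R) (k : nat) : R :=
  xi ^+ k / (1 + sum_over A (fun i => xi ^+ i)) * \1_([set 0%N] `|` A) k.

Definition pi_measure (A : set nat) (xi : R) (C : set nat) : R :=
  sum_over C (pi_pmf A xi).

End weights.

(* Main.v *)
(* Reading off, at each point, the size of the block of which it is the minimum
   (0 if there is none) encodes non-crossing partitions of [n] as words of length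
   n and sum n whose prefixes of length l have sum at least l. The weight xi^k / Z,
   with Z = 1 + \sum_(i in A) xi^i, turns the number N_n of partitions into
   N_n (xi / Z)^n, the probability that a word of i.i.d. letters of law pi_A is
   such a code. Writing G(y) = 1 + \sum_(i in A) y^i, the first-letter
   decomposition gives N(x) >= G(x N(x)) for the generating function N, while the
   equation satisfied by xi says that y -> G(y) / y is minimal at xi; hence N
   diverges beyond xi / Z and, N_n being supermultiplicative, N_n (xi / Z)^n decays
   subexponentially. Chernoff's bound for i.i.d. letters is exponential, so it
   survives the conditioning: zeta_C / n concentrates around pi_A(C). Then (ii) is
   a quotient of two such counts, and (i) follows from rotation invariance, which
   gives P(S_1 = k) = k E[zeta_{k}] / n. *)
Require Import Defs.
From HB Require Import structures.
From mathcomp Require Import all_boot all_order all_algebra.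
From mathcomp Require Import all_classical all_reals all_analysis.
From mathcomp Require Import ring lra zify.
Set Implicit Arguments.
Unset Strict Implicit.
Unset Printing Implicit Defensive.
Import Order.TTheory GRing.Theory Num.Theory.
Import numFieldNormedType.Exports.
Local Open Scope classical_set_scope.
Local Open Scope ring_scope.

(** * Geometry of the regular polygon *)

Definition crossing_free n (P : {set {set 'I_n}}) : Prop :=
  forall (B B' : {set 'I_n}) (a b c d : 'I_n), B \in P -> B' \in P ->
    a \in B -> c \in B -> b \in B' -> d \in B' -> (a < b < c)%N -> (c < d)%N ->
    B = B'.

Section geometry.
Variable R : realType.

(** Half of the polar angle: the difference of two half angles lies strictly between [-pi] and [pi],
    so the sign of its sine gives the order of the two vertices. *)
Definition half_angle n (i : 'I_n) : R := pi * i%:R / n%:R.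

Lemma vertexE n (i : 'I_n) : vertex R i =
  (cos (half_angle i) ^+ 2 - sin (half_angle i) ^+ 2,
   - (2 * cos (half_angle i) * sin (half_angle i))).
Proof.
rewrite /vertex /=.
have -> : 2 * pi * i%:R / n%:R = half_angle i + half_angle i :> R.
  by rewrite /half_angle -mulrA; ring.
by rewrite cosD sinD; congr pair; ring.
Qed.

Lemma half_angle_bounds n (i j : 'I_n) : (i < j)%N ->
  0 < half_angle j - half_angle i < pi.
Proof.
move=> ij; have n0 : 0 < n%:R :> R by rewrite ltr0n (leq_ltn_trans _ (ltn_ord i)).
have -> : half_angle j - half_angle i = pi * ((j - i)%N%:R / n%:R).
  by rewrite natrB ?(ltnW ij)// /half_angle; field; rewrite gt_eqF.
have pi0 := pi_gt0 R.
apply/andP; split; first by rewrite mulr_gt0// divr_gt0// ltr0n subn_gt0.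
rewrite gtr_pMr// ltr_pdivrMr// mul1r ltr_nat.
by rewrite (leq_ltn_trans (leq_subr _ _)).
Qed.

Lemma sin_half_gt0 n (i j : 'I_n) : (i < j)%N ->
  0 < sin (half_angle j - half_angle i).
Proof. by move=> /half_angle_bounds; exact: sin_gt0_pi. Qed.

(** The affine form vanishing on the chord between the vertices of half angles [s] and [e] (on the
    tangent if [s = e]). At the vertex of half angle [t] it is [cos (2t - s - e) - cos (e - s)],
    which factors as [2 sin (t - s) sin (e - t)]. *)
Definition arc_form (s e : R) (p : R^o * R^o) : R :=
  p.1 * cos (s + e) - p.2 * sin (s + e) - cos (e - s).

Lemma arc_form_vertex n (s e i : 'I_n) :
  arc_form (half_angle s) (half_angle e) (vertex R i) =
  2 * sin (half_angle i - half_angle s) * sin (half_angle e - half_angle i).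
Proof.
rewrite vertexE /arc_form /= !(sinB, cosB, sinD, cosD).
set c := cos (half_angle i); set d := sin (half_angle i).
set cs := cos (half_angle s); set ds := sin (half_angle s).
set ce := cos (half_angle e); set de := sin (half_angle e).
have cd : c ^+ 2 + d ^+ 2 = 1 by rewrite cos2Dsin2.
transitivity ((c ^+ 2 - d ^+ 2) * (cs * ce - ds * de) + 2 * c * d * (ds * ce + cs * de)
  - (c ^+ 2 + d ^+ 2) * (cs * ce + ds * de)); last by ring.
by rewrite cd; ring.
Qed.

Lemma conv_hull_sub (E C : set (R^o * R^o)) :
  @convex_set R (R^o * R^o)%type C -> E `<=` C -> conv_hull E `<=` C.
Proof. by move=> CC EC; exact: smallest_sub. Qed.

Lemma conv_hull_segment (E : set (R^o * R^o)) p q (t : R) :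
  0 <= t <= 1 -> E p -> E q -> conv_hull E (t *: p + (1 - t) *: q).
Proof.
move=> /andP[t0 t1] Ep Eq C [CC EC].
by have := CC p q (Itv01 t0 t1); rewrite !in_setE; apply; exact: EC.
Qed.

Lemma arc_form_ge0_convex s e :
  @convex_set R (R^o * R^o)%type [set p | 0 <= arc_form s e p].
Proof.
move=> [x1 x2] [y1 y2] l; rewrite !in_setE /= /arc_form /= => x0 y0.
have l0 : 0 <= l%:num by []. have l1 : l%:num <= 1 by [].
rewrite /GRing.scale /=.
rewrite (_ : _ - _ = l%:num * (x1 * cos (s + e) - x2 * sin (s + e) - cos (e - s))
  + (1 - l%:num) * (y1 * cos (s + e) - y2 * sin (s + e) - cos (e - s))).
  by rewrite addr_ge0// mulr_ge0// subr_ge0.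
by rewrite /unstable.onem /=; ring.
Qed.

Lemma arc_form_lt0_convex s e :
  @convex_set R (R^o * R^o)%type [set p | arc_form s e p < 0].
Proof.
apply/(@convex_setW R (R^o * R^o)%type).
move=> [x1 x2] [y1 y2]; rewrite !in_setE /= /arc_form /= => x0 y0 l l0 l1.
rewrite in_setE /= /GRing.scale /=.
rewrite (_ : _ - _ = l%:num * (x1 * cos (s + e) - x2 * sin (s + e) - cos (e - s))
  + (1 - l%:num) * (y1 * cos (s + e) - y2 * sin (s + e) - cos (e - s))).
  by rewrite addrC ltr_wnDl ?nmulr_llt0 ?pmulr_rlt0 ?pmulr_rle0 ?subr_gt0// ltW.
by rewrite /unstable.onem /=; ring.
Qed.

(* The coefficients are the Vandermonde minors of the four rows (c^2, cs, s^2),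
   where c and s are the cosine and the sine of the half angles. *)
Lemma chords_meet n (E E' : set 'I_n) (a b c d : 'I_n) :
  (a < b < c)%N -> (c < d)%N -> E a -> E c -> E' b -> E' d ->
  conv_hull (@vertex R n @` E) `&` conv_hull (@vertex R n @` E') !=set0.
Proof.
move=> /andP[ab bc] cd Ea Ec E'b E'd.
have Sab := sin_half_gt0 ab; have Sbc := sin_half_gt0 bc.
have Scd := sin_half_gt0 cd; have Sac := sin_half_gt0 (ltn_trans ab bc).
have Sbd := sin_half_gt0 (ltn_trans bc cd).
have Sad := sin_half_gt0 (ltn_trans ab (ltn_trans bc cd)).
have : [/\ vertex R a \in vertex R (n:=n) @` E, vertex R c \in vertex R (n:=n) @` E,
   vertex R b \in vertex R (n:=n) @` E' & vertex R d \in vertex R (n:=n) @` E'].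
  by rewrite !in_setE; split; exact: imageP.
rewrite !in_setE !vertexE => -[Va Vc Vb Vd].
have Ha := cos2Dsin2 (half_angle a). have Hb := cos2Dsin2 (half_angle b).
have Hc := cos2Dsin2 (half_angle c). have Hd := cos2Dsin2 (half_angle d).
rewrite !sinB in Sab Sbc Scd Sac Sbd Sad.
move: (cos (half_angle a)) (sin (half_angle a)) (cos (half_angle b))
  (sin (half_angle b)) (cos (half_angle c)) (sin (half_angle c))
  (cos (half_angle d)) (sin (half_angle d)) Ha Hb Hc Hd Sab Sbc Scd Sac Sbd Sad
  Va Vc Vb Vd => ca sa cb sb cc sc cd' sd Ha Hb Hc Hd Sab Sbc Scd Sac Sbd Sad.
set p := (X in _ X -> _) => Va; set q := (X in _ X -> _) => Vc.
set r := (X in _ X -> _) => Vb; set v := (X in _ X -> _) => Vd.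
pose wa := (sc * cb - cc * sb) * (sd * cc - cd' * sc) * (sd * cb - cd' * sb).
pose wb := (sd * cc - cd' * sc) * (sd * ca - cd' * sa) * (sc * ca - cc * sa).
pose wc := (sb * ca - cb * sa) * (sd * ca - cd' * sa) * (sd * cb - cd' * sb).
pose wd := (sb * ca - cb * sa) * (sc * cb - cc * sb) * (sc * ca - cc * sa).
have wa0 : 0 < wa by rewrite !mulr_gt0.
have wb0 : 0 < wb by rewrite !mulr_gt0.
have wc0 : 0 < wc by rewrite !mulr_gt0.
have wd0 : 0 < wd by rewrite !mulr_gt0.
(* The minors satisfy [wa * row a + wc * row c = wb * row b + wd * row d]. Adding the first and
   third entries, with [cos^2 + sin^2 = 1], shows that both pairs have the same total weight; the
   common point of the chords is then the barycentre of either pair. *)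
have wE : wa + wc = wb + wd.
  transitivity (wa * (ca ^+ 2 + sa ^+ 2) + wc * (cc ^+ 2 + sc ^+ 2)).
    by rewrite Ha Hc !mulr1.
  transitivity (wb * (cb ^+ 2 + sb ^+ 2) + wd * (cd' ^+ 2 + sd ^+ 2)).
    by rewrite /wa /wb /wc /wd; ring.
  by rewrite Hb Hd !mulr1.
have wac : 0 < wa + wc by rewrite addr_gt0.
have wac' : wa + wc != 0 by rewrite gt_eqF.
have frac01 (u w : R) : 0 < u -> 0 < w -> 0 <= u / (u + w) <= 1.
  move=> u0 w0; have uw : 0 < u + w by rewrite addr_gt0.
  apply/andP; split; first by rewrite divr_ge0 ?ltW.
  by rewrite ler_pdivrMr ?mul1r ?lerDl ?ltW.
exists ((wa / (wa + wc)) *: p + (1 - wa / (wa + wc)) *: q); split.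
  exact: conv_hull_segment (frac01 _ _ wa0 wc0) Va Vc.
have -> : (wa / (wa + wc)) *: p + (1 - wa / (wa + wc)) *: q =
          (wb / (wa + wc)) *: r + (1 - wb / (wa + wc)) *: v.
  have H x1 x2 x3 x4 : wa * x1 + wc * x2 = wb * x3 + wd * x4 ->
    wa / (wa + wc) * x1 + (1 - wa / (wa + wc)) * x2 =
    wb / (wa + wc) * x3 + (1 - wb / (wa + wc)) * x4.
    move=> H; have -> : 1 - wa / (wa + wc) = wc / (wa + wc) by field.
    have -> : 1 - wb / (wa + wc) = wd / (wa + wc).
      by rewrite [X in 1 - wb / X]wE; rewrite wE; field; rewrite -wE.
    by rewrite ![_ / _ * _]mulrAC -!mulrDl H.
  rewrite /p /q /r /v; congr pair => /=; apply: H;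
    by rewrite /wa /wb /wc /wd; ring.
by rewrite wE; exact: conv_hull_segment (frac01 _ _ wb0 wd0) Vb Vd.
Qed.

(** The chord from [s] to [e] separates the two hulls: [arc_form] is nonnegative at the vertices of
    [B] and negative at those of [B'], and both sign conditions define convex sets. *)
Lemma arc_separates n (B B' : {set 'I_n}) (s e : 'I_n) :
  (forall i, i \in B -> (s <= i <= e)%N) ->
  (forall i, i \in B' -> (i < s)%N || (e < i)%N) -> (s <= e)%N ->
  conv_hull (@vertex R n @` [set` B]) `&` conv_hull (@vertex R n @` [set` B'])
  = set0.
Proof.
move=> HB HB' se; rewrite -subset0 => p [Bp B'p].
have sinle (i j : 'I_n) : (i <= j)%N -> 0 <= sin (half_angle j - half_angle i).
  rewrite leq_eqVlt => /predU1P[/val_inj->|/sin_half_gt0/ltW//].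
  by rewrite subrr sin0.
have : 0 <= arc_form (half_angle s) (half_angle e) p.
  move: p Bp {B'p}; apply: conv_hull_sub; first exact: arc_form_ge0_convex.
  move=> _ [i /= /HB/andP[si ie] <-]; rewrite arc_form_vertex.
  by rewrite !mulr_ge0// sinle.
apply/negP; rewrite -ltNge.
move: p B'p {Bp}; apply: conv_hull_sub; first exact: arc_form_lt0_convex.
move=> _ [i /= /HB' H <-]; rewrite arc_form_vertex.
case/orP: H => [is_|ei].
  rewrite -(opprB (half_angle s)) sinN mulrN mulNr oppr_lt0 !mulr_gt0//.
    exact: sin_half_gt0.
  exact: sin_half_gt0 (leq_trans is_ se).
rewrite -(opprB (half_angle i) (half_angle e)) sinN mulrN oppr_lt0 !mulr_gt0//.
  exact: sin_half_gt0 (leq_ltn_trans se ei).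
exact: sin_half_gt0.
Qed.

(** Alternating blocks have intersecting chords. Conversely, let [B'] be the block with the larger
    minimum, spanning from [s'] to [e]: a point [i] of the other block in this span would give the
    alternation [s < s' < i < e], with [s] the minimum of [B]. Hence [B] avoids the span and
    [arc_separates] applies. *)
Lemma noncrossingP n (P : {set {set 'I_n}}) :
  finset.partition P [set: 'I_n]%SET -> noncrossing R P <-> crossing_free P.
Proof.
move=> /and3P[_ /finset.trivIsetP tP P0]; split.
  move=> ncP B B' a b c d BP B'P aB cB bB' dB' abc cd.
  by apply: (ncP B B') => //; exact: (chords_meet abc cd).
move=> cf B B' /= BP B'P meet; apply/eqP; apply: contraPT meet => BB'.
have /finset.set0Pn[x xB] : B != finset.set0 by apply: contraNneq P0 => <-.
have /finset.set0Pn[y yB'] : B' != finset.set0 by apply: contraNneq P0 => <-.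
wlog : B B' BP B'P x y xB yB' BB' / ([arg min_(i < x in B) val i] <= [arg min_(i < y in B') val i])%N.
  move=> W; case: (leqP [arg min_(i < x in B) val i] [arg min_(i < y in B') val i]).
    exact: W.
  by move=> /ltnW; rewrite setIC; apply: W; rewrite // eq_sym.
case: arg_minnP => // s sB smin; case: arg_minnP => // s' s'B' s'min ss'.
case: (@arg_maxnP _ y (mem B') val) => // e eB' emax; rewrite setIC.
rewrite (@arc_separates _ B' B s' e) ?set0P ?eqxx//.
- by move=> [].
- by move=> i iB'; rewrite s'min//=; exact: emax.
- move=> i iB; rewrite ltnNge [X in _ || X]ltnNge -negb_and; apply: contraNN BB' => /andP[s'i ie].
  have disj j : j \in B -> j \in B' -> B = B'.
    move=> jB jB'; apply/eqP; apply: contraT => /(tP _ _ BP B'P)/pred0P/(_ j).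
    by rewrite /= jB jB'.
  apply/eqP; move: ss'; rewrite leq_eqVlt => /predU1P[/val_inj|] ss'.
    by apply: (disj s) => //; rewrite ss'.
  move: s'i; rewrite leq_eqVlt => /predU1P[/val_inj|] s'i.
    by apply: (disj i) => //; rewrite -s'i.
  move: ie; rewrite leq_eqVlt => /predU1P[/val_inj|] ie.
    by apply: (disj i) => //; rewrite ie.
  by apply: (cf B B' s s' i e) => //; rewrite ss'.
- exact: s'min.
Qed.

End geometry.

(** * Noncrossing partitions as lattice words *)

Lemma sum_nth n (s : seq nat) : size s = n -> (\sum_(j < n) nth 0 s j = sumn s)%N.
Proof. by move=> <-; rewrite sumnE (big_nth 0%N) big_mkord. Qed.

Section prefix_words.
Variable A : set nat.

Definition letter (a : nat) : bool := (a == 0%N) || (a \in A).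

(** Lukasiewicz paths: a letter [a] is a step [a - 1], and the path starts at height [e], stays
    nonnegative and ends at 0. A general [e] is what the recursion on the first letter requires. *)
Fixpoint good (e : nat) (s : seq nat) : bool :=
  if s is a :: s' then
    [&& letter a, 0 < e + a & good (e + a).-1 s']%N
  else e == 0%N.

Lemma goodP e (s : seq nat) : reflect
  [/\ forall a : nat, a \in s -> letter a,
      forall l, (l <= size s)%N -> (l <= e + sumn (take l s))%N
    & (e + sumn s)%N = size s] (good e s).
Proof.
elim: s e => [|a s IHs] e /=.
  apply: (iffP eqP) => [->|[_ _]]; last by rewrite addn0.
  by split => // l; rewrite leqn0 => /eqP->.
apply: (iffP and3P) => [[aA ea /IHs[sA spre stot]]|[sA spre stot]].
  split => [b|[|l]//= /spre H|]; last 2 first.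
  - lia.
  - lia.
  by rewrite in_cons => /predU1P[->|/sA].
have ea : (0 < e + a)%N by have := spre 1%N isT; rewrite /= take0 /=; lia.
split=> //; first by rewrite sA ?mem_head.
apply/IHs; split => [b bs|l ls|]; first by rewrite sA ?in_cons ?bs ?orbT.
- by have := spre l.+1 ls; rewrite /=; lia.
- lia.
Qed.

End prefix_words.

(** * Bijection between block-minimum maps and lattice words *)

Section noncrossing_codes.
Variable n : nat.
Implicit Types (m : 'I_n -> 'I_n) (s : seq nat).

(* [m] sends a point to the least element of its block. *)
Definition nc_min m := [/\ forall x : 'I_n, (m x <= x)%N, forall x, m (m x) = m x
  & forall a b c d : 'I_n, (a < b < c)%N -> (c < d)%N -> m a = m c -> m b = m d ->
      m a = m b].

Definition min_code m : seq nat := [seq #|[set x | m x == i]%SET| | i <- enum 'I_n].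

Lemma size_min_code m : size (min_code m) = n.
Proof. by rewrite size_map size_enum_ord. Qed.

Lemma nth_min_code m (i : 'I_n) : nth 0%N (min_code m) i = #|[set x | m x == i]%SET|.
Proof. by rewrite (nth_map i) ?size_enum_ord// nth_ord_enum. Qed.

Lemma sumn_take_min_code m l : (l <= n)%N ->
  sumn (take l (min_code m)) = #|[set x | (m x < l)%N]%SET|.
Proof.
elim: l => [|l IHl] ln.
  by rewrite take0; apply/esym/eqP; rewrite cards_eq0; apply/eqP/setP => x; rewrite !inE.
rewrite (take_nth 0%N) ?size_min_code// sumn_rcons IHl ?(ltnW ln)//.
rewrite (nth_min_code m (Ordinal ln)) -cardsUI.
rewrite [X in (_ + X)%N](_ : _ = 0%N); last first.
  apply/eqP; rewrite cards_eq0; apply/eqP/setP => x; rewrite !inE -val_eqE /=.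
  by case: ltngtP.
by rewrite addn0; apply: eq_card => x; rewrite !inE -val_eqE /= ltnS [RHS]leq_eqVlt orbC.
Qed.

Lemma sumn_min_code m : sumn (min_code m) = n.
Proof.
rewrite -{1}[min_code m]take_size size_min_code sumn_take_min_code//.
by rewrite -[RHS]card_ord; apply: eq_card => x; rewrite !inE ltn_ord.
Qed.

(** The points still owed, at time [l], to blocks opened before [l]; their number is the height of
    the path after [l] letters. *)
Definition straddle m l : {set 'I_n} := [set x : 'I_n | (l <= x)%N & (m x < l)%N]%SET.

Lemma sumn_take_straddle m l : (forall x, (m x <= x)%N) -> (l <= n)%N ->
  sumn (take l (min_code m)) = (l + #|straddle m l|)%N.
Proof.
move=> mle ln; rewrite sumn_take_min_code//.
rewrite -(cardsID [set x : 'I_n | (x < l)%N]%SET); congr addn; last first.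
  by apply: eq_card => x; rewrite !inE -leqNgt.
have winj : injective (widen_ord ln) by move=> x y /(congr1 val) /= /val_inj.
rewrite -[RHS](card_ord l) -(card_imset _ winj).
apply: eq_card => x; rewrite !inE; apply/andP/imsetP => [[_ xl]|[y _ ->]].
  by exists (Ordinal xl) => //; apply: ord_inj.
by split; rewrite ?(leq_ltn_trans (mle _))/=.
Qed.

(* With S l := sumn (take l s) - l, [j] is the last time up to [x] at which
   S is at most S (x + 1). *)
Definition owner s (j x : nat) := [/\ (j <= x)%N,
   (sumn (take j s) + x.+1 <= sumn (take x.+1 s) + j)%N
  & forall l, (j < l <= x)%N ->
      (sumn (take x.+1 s) + l < sumn (take l s) + x.+1)%N].

Lemma owner_uniq s j k x : owner s j x -> owner s k x -> j = k.
Proof.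
move=> [jx Sj Lj] [kx Sk Lk]; case: (ltngtP j k) => // jk.
- by have := Lj k; rewrite jk kx => /(_ isT); lia.
- by have := Lk j; rewrite jk jx => /(_ isT); lia.
Qed.

(** Heights count straddling points. By non-crossing, every point straddling [m x] lies beyond [x],
    so it straddles [x.+1] too. For [m x < l <= x], points straddling [x.+1] already straddle [l],
    while [x] straddles [l] only, whence the strict inequality. Since owners are unique, the code
    determines [m]. *)
Lemma owner_min_code m x : nc_min m -> owner (min_code m) (m x) x.
Proof.
move=> [mle mK ncr].
have Sle := sumn_take_straddle mle.
split => //.
  rewrite !Sle ?(ltnW (ltn_ord _)) ?ltn_ord//.
  suff : (#|straddle m (m x)| <= #|straddle m x.+1|)%N by lia.
  apply/subset_leq_card/fintype.subsetP => y; rewrite !inE => /andP[xy my].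
  rewrite (leq_trans my (leqW (mle x))) andbT ltnNge; apply/negP => yx.
  have my_mx : m y <> m x by move=> E; rewrite E ltnn in my.
  have xy' : (m x < y)%N.
    by rewrite ltn_neqAle xy andbT; apply: contraPneq my_mx => /val_inj <-; rewrite mK.
  have yx' : (y < x)%N by rewrite ltn_neqAle yx andbT; apply: contraPneq my_mx => /val_inj ->.
  by apply: my_mx; rewrite -(mK y) -(mK x) (ncr (m y) (m x) y x) ?mK// my xy'.
move=> l /andP[xl lx].
have ln : (l <= n)%N by rewrite (leq_trans lx)// ltnW.
rewrite !Sle//.
suff : (#|straddle m x.+1| < #|straddle m l|)%N by lia.
apply: proper_card; apply/properP; split; last first.
  by exists x; rewrite !inE ?lx ?xl// ltnn.
apply/fintype.subsetP => y; rewrite !inE => /andP[xy my].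
rewrite (leq_trans lx (ltnW xy)) ltnNge; apply/negP => lmy.
have mxmy : m x <> m y by move=> E; rewrite -E leqNgt xl in lmy.
have myx : (m y < x)%N.
  move: my; rewrite ltnS leq_eqVlt => /predU1P[/val_inj E|//].
  by case: mxmy; rewrite -E mK.
apply: mxmy; rewrite -(mK x) -(mK y); apply: (ncr (m x) (m y) x y); rewrite ?mK//.
by rewrite (leq_trans xl lmy).
Qed.

Lemma min_code_inj m1 m2 : nc_min m1 -> nc_min m2 -> min_code m1 = min_code m2 -> m1 =1 m2.
Proof.
move=> nc1 nc2 E x; apply: ord_inj.
by apply: (@owner_uniq (min_code m1) _ _ x); [|rewrite E]; exact: owner_min_code.
Qed.

Lemma min_code_prefix m : nc_min m -> forall l, (l <= n)%N ->
  (l <= sumn (take l (min_code m)))%N.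
Proof. by move=> [mle _ _] l ln; rewrite sumn_take_straddle// leq_addr. Qed.

Lemma owner_exists s : (forall l, (l <= size s)%N -> (l <= sumn (take l s))%N) ->
  forall x, (x < size s)%N -> exists j, owner s j x.
Proof.
move=> spre x xs.
pose Q j := (j <= x)%N && (sumn (take j s) + x.+1 <= sumn (take x.+1 s) + j)%N.
have Q0 : exists j, Q j by exists 0%N; rewrite /Q take0 addn0 spre.
have Qb j : Q j -> (j <= x)%N by case/andP.
case: (ex_maxnP Q0 Qb) => j /andP[jx jS] jmax; exists j; split => // l /andP[jl lx].
rewrite ltnNge; apply/negP => H; have := jmax l; rewrite /Q lx H => /(_ isT).
by rewrite leqNgt jl.
Qed.

(** The inverse map sends each position to its owner. The fibre of [j] has at most [nth 0 s j]
    elements; as the fibre sizes and the letters have the same total [n], all these bounds are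
    equalities. *)
Lemma min_code_surj s : size s = n -> sumn s = n ->
  (forall l, (l <= n)%N -> (l <= sumn (take l s))%N) ->
  exists2 m, nc_min m & min_code m = s.
Proof.
move=> sz sn spre.
have takeS i : (i < n)%N -> sumn (take i.+1 s) = (sumn (take i s) + nth 0 s i)%N.
  by move=> ilt; rewrite (take_nth 0%N) ?sz// sumn_rcons.
have /fin_all_exists[m mP] : forall x : 'I_n, exists j : 'I_n, owner s j x.
  move=> x; have [||j jx] := @owner_exists s _ x; rewrite ?sz//.
  have jn : (j < n)%N by case: jx => jx _ _; exact: leq_ltn_trans jx (ltn_ord x).
  by exists (Ordinal jn).
have mK x : m (m x) = m x.
  apply: ord_inj; apply: (owner_uniq (mP (m x))).
  have [mx1 mx2 mx3] := mP x; split => // [|l]; last by case: (ltngtP l (m x)).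
  (* If [m x < x], the height just after [m x] exceeds the one after [x], which is at least the
     height at [m x]; so the path does not go down at [m x], which therefore owns itself. *)
  have [E|mxx] := eqVneq (m x : nat) x; first by rewrite E in mx2 *.
  have mxx' : (m x < x)%N by rewrite ltn_neqAle mxx.
  have := mx3 (m x).+1; rewrite ltnS leqnn mxx' => /(_ isT).
  lia.
have ncr : forall a b c d : 'I_n, (a < b < c)%N -> (c < d)%N -> m a = m c ->
    m b = m d -> m a = m b.
  move=> a b c d /andP[ab bc] cd ac bd; apply: ord_inj.
  have [a1 a2 a3] := mP a; have [b1 b2 b3] := mP b.
  have [c1 c2 c3] := mP c; have [d1 d2 d3] := mP d.
  rewrite -ac in c1 c2 c3; rewrite -bd in d1 d2 d3.
  (* Either strict order closes a cycle of inequalities between heights: at [m b], [d.+1] and [c.+1]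
     in the first case, at [m a], [c.+1] and [b.+1] in the second. *)
  case: (ltngtP (m a) (m b)) => // mm.
    by have := c3 (m b) ltac:(lia); have := d3 c.+1 ltac:(lia); lia.
  by have := b3 (m a) ltac:(lia); have := c3 b.+1 ltac:(lia); lia.
exists m; first by split => // x; case: (mP x).
have card_le (j : 'I_n) : (#|[set x | m x == j]%SET| <= nth 0 s j)%N.
  (* x |-> S (x + 1) - S j is injective on the block of j *)
  have [->|[x0]] := finset.set_0Vmem [set x | m x == j]%SET; first by rewrite cards0.
  rewrite inE => /eqP mx0.
  pose f (x : 'I_n) := (sumn (take x.+1 s) + j - (sumn (take j s) + x.+1))%N.
  have fP (x : 'I_n) : m x == j -> (f x < nth 0 s j)%N.
    move=> /eqP mx; have [jx x1 x2] := mP x; rewrite mx in jx x1 x2.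
    have tj := takeS j (ltn_ord j); rewrite /f.
    case: (ltngtP j x) jx => // [jx|jx] _; last by rewrite -jx in x1 *; lia.
    by have := x2 j.+1 ltac:(lia); lia.
  case: (nth 0 s j) fP => [|k] fP; first by have := fP x0; rewrite mx0 eqxx => /(_ isT).
  rewrite -[X in (_ <= X)%N]card_ord.
  rewrite -(@card_in_imset _ _ (fun x => inord (f x) : 'I_k.+1)) ?max_card// => x y.
  rewrite !inE => mx my /(congr1 val); rewrite /= !inordK ?fP// => fxy; apply: ord_inj.
  have [x1 x2 x3] := mP x; have [y1 y2 y3] := mP y.
  rewrite (eqP mx) in x1 x2 x3; rewrite (eqP my) in y1 y2 y3.
  case: (ltngtP x y) => // xy.
    by have := y3 x.+1 ltac:(lia); rewrite /f in fxy; lia.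
  by have := x3 y.+1 ltac:(lia); rewrite /f in fxy; lia.
have tot : (\sum_(j < n) #|[set x | m x == j]%SET| = \sum_(j < n) nth 0 s j)%N.
  rewrite (sum_nth sz) sn; transitivity (sumn (min_code m)); last exact: sumn_min_code.
  by rewrite -(sum_nth (size_min_code m)); apply: eq_bigr => j _; rewrite nth_min_code.
apply: (@eq_from_nth _ 0%N) => [|i]; rewrite size_min_code ?sz// => ilt.
rewrite (nth_min_code m (Ordinal ilt)) /=.
have := leqif_sum (fun (j : 'I_n) (_ : true) => leqif_eq (card_le j)).
by move=> [_]; rewrite tot eqxx => /esym/forallP/(_ (Ordinal ilt))/eqP.
Qed.

End noncrossing_codes.

(** * From set partitions to block minima and back *)

Section partition_codes.
Variable n : nat.
Implicit Types (P : {set {set 'I_n}}) (m : 'I_n -> 'I_n).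

Definition block_min P (x : 'I_n) : 'I_n :=
  [arg min_(y < x in finset.pblock P x) val y].

Section one_partition.
Variable P : {set {set 'I_n}}.
Hypothesis partP : finset.partition P [set: 'I_n]%SET.

Let tP : finset.trivIset P. Proof. by case/and3P: partP. Qed.

Let coverP x : x \in finset.cover P.
Proof. by rewrite (cover_partition partP) finset.inE. Qed.

Let pblockxx x : x \in finset.pblock P x.
Proof. by rewrite finset.mem_pblock. Qed.

Lemma block_min_mem x : block_min P x \in finset.pblock P x.
Proof. by rewrite /block_min; case: arg_minnP. Qed.

Lemma block_min_le x y : y \in finset.pblock P x -> (block_min P x <= y)%N.
Proof. by rewrite /block_min; case: arg_minnP => // ? _; apply. Qed.

Lemma block_min_eq x y :
  (block_min P x == block_min P y) = (finset.pblock P x == finset.pblock P y).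
Proof.
apply/eqP/eqP => [E|E].
  rewrite -(same_pblock tP (block_min_mem x)) E.
  by rewrite (same_pblock tP (block_min_mem y)).
apply/ord_inj/eqP; rewrite eqn_leq !block_min_le//.
  by rewrite -E block_min_mem.
by rewrite E block_min_mem.
Qed.

Lemma block_minK x : block_min P (block_min P x) = block_min P x.
Proof. by apply/eqP; rewrite block_min_eq (same_pblock tP (block_min_mem x)). Qed.

Lemma pblockE x : finset.pblock P x = [set y | block_min P y == block_min P x]%SET.
Proof. by apply/setP => y; rewrite !finset.inE eq_sym block_min_eq eq_pblock. Qed.

Lemma block_min_partition : preim_partition (block_min P) [set: 'I_n]%SET = P.
Proof.
rewrite -[RHS](preim_partition_pblock partP); apply: eq_imset => x.
by apply/setP => y; rewrite !finset.inE block_min_eq.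
Qed.

Lemma block_min_nc : crossing_free P -> nc_min (block_min P).
Proof.
move=> cf; split => [x|x|a b c d abc cd ac bd].
- by rewrite block_min_le.
- exact: block_minK.
- apply/eqP; rewrite block_min_eq.
  move/eqP : ac bd; rewrite block_min_eq => /eqP ac /eqP; rewrite block_min_eq => /eqP bd.
  apply/eqP; apply: (cf _ _ a b c d) => //; rewrite ?pblock_mem//.
    by rewrite ac.
  by rewrite bd.
Qed.

(* A block is identified with its minimum, where the code is the block size. *)
Lemma zeta_code (C : set nat) : (forall i, C i -> (1 <= i)%N) ->
  zeta C P = #|[set x : 'I_n | nth 0%N (min_code (block_min P)) x \in C]%SET|.
Proof.
move=> C1; rewrite /zeta; set S := RHS.
have SE x : x \in [set x : 'I_n | nth 0%N (min_code (block_min P)) x \in C]%SET ->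
    block_min P x = x /\ #|finset.pblock P x| \in C.
  rewrite finset.inE nth_min_code => H.
  have [x0] : exists x0, block_min P x0 = x.
    have := C1 _ (set_mem H); rewrite card_gt0 => /finset.set0Pn[x0].
    by rewrite finset.inE => /eqP; exists x0.
  move=> x0x; have xx : block_min P x = x by rewrite -{1}x0x block_minK.
  by rewrite pblockE xx.
rewrite /S -(@card_in_imset _ _ (finset.pblock P)); last first.
  move=> x y /SE[xx _] /SE[yy _] /eqP.
  by rewrite -block_min_eq xx yy => /eqP.
apply: eq_card => B; rewrite finset.inE; apply/andP/imsetP => [[BP BC]|[x /SE[xx xC] ->]].
  have /finset.set0Pn[x xB] := partition_neq0 partP BP.
  have BE : finset.pblock P x = B by apply: def_pblock.
  exists (block_min P x); last by rewrite (same_pblock tP (block_min_mem x)).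
  by rewrite finset.inE nth_min_code -pblockE BE.
by rewrite pblock_mem.
Qed.

End one_partition.

Section from_code.
Variable m : 'I_n -> 'I_n.
Hypothesis m_nc : nc_min m.
Let P := preim_partition m [set: 'I_n]%SET.

Lemma preim_pblock x : finset.pblock P x = [set y | m y == m x]%SET.
Proof.
apply: def_pblock; rewrite ?finset.inE//.
  by have /and3P[] := preim_partitionP m [set: 'I_n]%SET.
apply/imsetP; exists x; rewrite ?finset.inE//.
by apply/setP => y; rewrite !finset.inE eq_sym.
Qed.

Lemma preim_crossing_free : crossing_free P.
Proof.
have tP : finset.trivIset P by have /and3P[] := preim_partitionP m [set: 'I_n]%SET.
move=> B B' a b c d BP B'P aB cB bB' dB' abc cd.
have [_ _ ncr] := m_nc.
have Ba := def_pblock tP BP aB; have Bb := def_pblock tP B'P bB'.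
move: cB dB'; rewrite -Ba -Bb !preim_pblock !finset.inE => /eqP ca /eqP db.
by rewrite (ncr a b c d).
Qed.

Lemma preim_block_min : block_min P =1 m.
Proof.
have [mle mK _] := m_nc => x.
have := block_min_mem (preim_partitionP m _) x.
rewrite preim_pblock finset.inE => /eqP bx.
apply/ord_inj/eqP; rewrite eqn_leq; apply/andP; split; last by rewrite -bx mle.
apply: block_min_le; first exact: preim_partitionP.
by rewrite preim_pblock finset.inE mK.
Qed.

End from_code.

End partition_codes.

Lemma eq_min_code n (m1 m2 : 'I_n -> 'I_n) : m1 =1 m2 -> min_code m1 = min_code m2.
Proof.
move=> E; apply: eq_map => i.
by apply: eq_card => x; rewrite !finset.inE E.
Qed.

Section nc_codes.
Variables (R : realType) (A : set nat) (n : nat).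
Hypothesis A_pos : forall i, A i -> (1 <= i)%N.

Lemma NCP (P : {set {set 'I_n}}) : reflect
  [/\ finset.partition P [set: 'I_n]%SET, crossing_free P
    & forall B, B \in P -> #|B| \in A] (P \in NC R A n).
Proof.
rewrite finset.inE; apply: (iffP and3P) => -[partP].
  by move=> /asboolP/(noncrossingP R partP) cf /forall_inP.
move=> cf /forall_inP PA; split => //.
by apply/asboolP/noncrossingP.
Qed.

Definition partition_code (P : {set {set 'I_n}}) := min_code (block_min P).

Lemma partition_code_inj : {in NC R A n &, injective partition_code}.
Proof.
move=> P Q /NCP[partP cfP _] /NCP[partQ cfQ _] E.
rewrite -(block_min_partition partP) -(block_min_partition partQ).
have EE := min_code_inj (block_min_nc partP cfP) (block_min_nc partQ cfQ) E.
by apply: eq_imset => x; apply/setP => y; rewrite !finset.inE !EE.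
Qed.

Lemma partition_code_good P : P \in NC R A n -> good A 0 (partition_code P).
Proof.
move=> /NCP[partP cf PA]; have nc := block_min_nc partP cf.
apply/goodP; split; rewrite ?size_min_code ?sumn_min_code//.
  move=> a /mapP[i _ ->]; have [->|[x]] := finset.set_0Vmem [set x | block_min P x == i]%SET.
    by rewrite /letter cards0.
  rewrite finset.inE => /eqP <-; rewrite -pblockE//; apply/orP; right.
  by apply: PA; rewrite pblock_mem// (cover_partition partP) finset.inE.
by move=> l ln; rewrite add0n min_code_prefix.
Qed.

Lemma partition_code_surj s : size s = n -> good A 0 s ->
  exists2 P, P \in NC R A n & partition_code P = s.
Proof.
move=> sz /goodP[sA spre]; rewrite add0n sz => ssum.
have [l ln|m nc ms] := min_code_surj sz ssum.
  by rewrite -[X in (_ <= X)%N]add0n spre ?sz.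
exists (preim_partition m [set: 'I_n]%SET); last first.
  by rewrite /partition_code (eq_min_code (preim_block_min nc)).
apply/NCP; split; [exact: preim_partitionP|exact: preim_crossing_free|].
move=> B BP; have partP := preim_partitionP m [set: 'I_n]%SET.
have /finset.set0Pn[x xB] := partition_neq0 partP BP.
have tP : finset.trivIset (preim_partition m [set: 'I_n]%SET) by case/and3P: partP.
rewrite -(def_pblock tP BP xB) preim_pblock.
have : #|[set y | m y == m x]%SET| \in s.
  by rewrite -ms; apply/mapP; exists (m x); rewrite ?mem_enum.
move/sA => /orP[|//]; rewrite cards_eq0 => /eqP/setP/(_ x).
by rewrite !finset.inE eqxx.
Qed.

End nc_codes.

(** * Rotation invariance *)

Lemma card_set_cond (T : finType) (S : {set T}) (E : pred T) :
  #|[set x in S | E x]%SET| = (\sum_(x in S) E x)%N.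
Proof.
rewrite -sum1_card big_mkcond [RHS]big_mkcond; apply: eq_bigr => x _.
by rewrite finset.inE; case: (x \in S); case: (E x).
Qed.

Section rotation.
Variables (R : realType) (A : set nat) (n : nat).
Implicit Types P : {set {set 'I_n.+1}}.

Let rot P : {set {set 'I_n.+1}} := [set (@ordS n.+1) @: (B : {set 'I_n.+1}) | B in P]%SET.

Let rot_partition P :
  finset.partition P [set: 'I_n.+1]%SET -> finset.partition (rot P) [set: 'I_n.+1]%SET.
Proof.
move=> partP; have injS := @ordS_inj n.+1.
have <- : ((@ordS n.+1) @: [set: 'I_n.+1] = [set: 'I_n.+1])%SET.
  apply/setP => i; rewrite !finset.inE; apply/imsetP; exists (ord_pred i) => //.
  by rewrite ord_predK.
by rewrite (imset_partition _ _ injS).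
Qed.

Let rot_crossing_free P : crossing_free P -> crossing_free (rot P).
Proof.
move=> cf _ _ a b c d /imsetP[B BP ->] /imsetP[B' B'P ->].
move=> /imsetP[a' aB ->] /imsetP[c' cB ->] /imsetP[b' bB ->] /imsetP[d' dB ->] /=.
have ordSE (i : 'I_n.+1) : (i.+1 %% n.+1 = if i == n :> nat then 0 else i.+1)%N.
  have [->|iN] := eqVneq (i : nat) n; first by rewrite modnn.
  by rewrite modn_small// ltnS ltn_neqAle iN -ltnS ltn_ord.
rewrite !ordSE; have := ltn_ord a'; have := ltn_ord b'; have := ltn_ord c'.
have := ltn_ord d' => da db dc dd abc cd; suff -> : B = B' by [].
(* Only [a'] can be the last point, since rotation sends that point to 0, below all others. In that
   case the alternation before rotation reads [b' < c' < d' < a']. *)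
move: abc cd; case: (eqVneq (b' : nat) n); first by lia.
case: (eqVneq (c' : nat) n); first by lia.
case: (eqVneq (d' : nat) n); first by lia.
case: (eqVneq (a' : nat) n) => [an|an] dn cn bn abc cd.
  by apply/esym; apply: (cf B' B b' c' d' a') => //; lia.
by apply: (cf B B' a' b' c' d') => //; lia.
Qed.

Lemma card_block_ordS k (i : 'I_n.+1) :
  (#|[set P in NC R A n.+1 | #|finset.pblock P i| == k]%SET| <=
   #|[set P in NC R A n.+1 | #|finset.pblock P (ordS i)| == k]%SET|)%N.
Proof.
have injS := @ordS_inj n.+1.
rewrite -(card_imset _ (imset_inj (imset_inj injS))).
apply/subset_leq_card/fintype.subsetP => _ /imsetP[P + ->].
rewrite finset.inE => /andP[/NCP[partP cf PA] Pk].
rewrite finset.inE; apply/andP; split.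
  apply/NCP; split; [exact: rot_partition|exact: rot_crossing_free|].
  by move=> _ /imsetP[B /PA BA ->]; rewrite (card_imset _ injS).
have iP : i \in finset.cover P by rewrite (cover_partition partP) finset.inE.
rewrite (@def_pblock _ _ ((@ordS n.+1) @: finset.pblock P i)%SET).
- by rewrite (card_imset _ injS).
- by have /and3P[] := rot_partition partP.
- by rewrite imset_f// pblock_mem.
- by rewrite imset_f// mem_pblock.
Qed.

(** The inequalities of [card_block_ordS], followed once around the cycle, return to their starting
    value, so all of them are equalities. *)
Lemma card_block_ord0 k (i : 'I_n.+1) :
  #|[set P in NC R A n.+1 | #|finset.pblock P i| == k]%SET| =
  #|[set P in NC R A n.+1 | #|finset.pblock P ord0| == k]%SET|.
Proof.
pose f (j : 'I_n.+1) := #|[set P in NC R A n.+1 | #|finset.pblock P j| == k]%SET|.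
have mono p q : (p <= q)%N ->
    (f (iter p (@ordS n.+1) ord0) <= f (iter q (@ordS n.+1) ord0))%N.
  by move=> /subnK <-; elim: (q - p)%N => // r /leq_trans; apply; exact: card_block_ordS.
have iterE p : nat_of_ord (iter p (@ordS n.+1) ord0) = (p %% n.+1)%N.
  by elim: p => [|p IHp] //=; rewrite IHp -addn1 modnDml addn1.
have iE : iter i (@ordS n.+1) ord0 = i.
  by apply: ord_inj; rewrite iterE modn_small.
have nE : iter n.+1 (@ordS n.+1) ord0 = ord0 by apply: ord_inj; rewrite iterE modnn.
have := mono i n.+1 (ltnW (ltn_ord i)); rewrite iE nE => le1.
have := mono 0%N i (leq0n _); rewrite iE => le2.
by apply/eqP; rewrite eqn_leq; apply/andP.
Qed.

(** Double counting of the pairs of a partition and a point in a block of size [k]: by rotation all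
    points contribute equally, and each block of size [k] contributes [k] points. *)
Lemma card_first_block k :
  (n.+1 * #|[set P in NC R A n.+1 | first_block_size P == k]%SET| =
   \sum_(P in NC R A n.+1) k * zeta [set k]%classic P)%N.
Proof.
transitivity (\sum_(i < n.+1)
    #|[set P in NC R A n.+1 | #|finset.pblock P i| == k]%SET|)%N.
  by rewrite (eq_bigr _ (fun i _ => card_block_ord0 k i)) sum_nat_const card_ord.
transitivity (\sum_(i < n.+1) \sum_(P in NC R A n.+1) (#|finset.pblock P i| == k))%N.
  by apply: eq_bigr => i _; exact: card_set_cond.
rewrite exchange_big /=; apply: eq_bigr => P /NCP[partP _ _].
transitivity (\sum_(i in [set: 'I_n.+1]%SET) (#|finset.pblock P i| == k))%N.
  by apply: eq_bigl => i; rewrite finset.inE.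
rewrite (set_partition_big _ partP) /=.
have tP : finset.trivIset P by case/and3P: partP.
rewrite /zeta card_set_cond big_distrr /=.
apply: eq_bigr => B BP; under eq_bigr => x xB do rewrite (def_pblock tP BP xB).
rewrite sum_nat_const; have [->|kB] := eqVneq #|B| k.
  by rewrite mem_set.
by rewrite memNset ?muln0// => /= E; rewrite E eqxx in kB.
Qed.

End rotation.

(** * Counting *)

Section words.
Variable A : set nat.

(** The alphabet can be cut at [n]: after a larger letter the path is too high to come back to 0 in
    the remaining steps. *)
Fixpoint words (e n : nat) : seq (seq nat) :=
  if n is n'.+1 then
    [seq a :: s | a <- [seq a <- iota 0 n.+1 | letter A a && (0 < e + a)],
                  s <- words (e + a).-1 n']%N
  else if e == 0%N then [:: [::]] else [::].

Lemma mem_words e n s : (s \in words e n) = (size s == n) && good A e s.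
Proof.
elim: n e s => [|n IHn] e s.
  rewrite /=; case: eqVneq => [->|e0]; first by case: s.
  by rewrite in_nil; case: s => //=; rewrite (negbTE e0).
apply/allpairsPdep/idP => [[a [t [aA tw ->]]]|].
  move: aA tw; rewrite mem_filter IHn => /andP[/andP[aA ea] _] /andP[/eqP <- gt].
  by rewrite /= eqxx aA ea.
case: s => [|a t]; first by [].
move=> /andP[/eqP[sz] /and3P[aA ea gt]].
exists a, t; split => //; last by rewrite IHn sz eqxx.
rewrite mem_filter aA ea mem_iota/= add0n.
have /goodP[_ _] := gt; rewrite sz; lia.
Qed.

Lemma uniq_words e n : uniq (words e n).
Proof.
elim: n e => [|n IHn] e; first by rewrite /=; case: ifP.
apply: allpairs_uniq_dep; first by rewrite filter_uniq// iota_uniq.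
  by move=> a _; exact: IHn.
by move=> [a s] [b t] _ _ [-> /= ->].
Qed.

Definition cnt e n := size (words e n).

Lemma cnt0 e : cnt e 0 = (e == 0%N).
Proof. by rewrite /cnt /=; case: ifP. Qed.

Lemma cnt_eq0 e n : (n < e)%N -> cnt e n = 0%N.
Proof.
move=> ne; rewrite /cnt; case E: (words e n) => [//|s l].
have : s \in words e n by rewrite E mem_head.
rewrite mem_words => /andP[/eqP sz /goodP[_ _]]; rewrite sz; lia.
Qed.

(** The free cutoff [B] lets different lengths share one range of letters, so that sums can be
    exchanged. *)
Lemma cntS B e n : (n.+1 < B)%N ->
  cnt e n.+1 = (\sum_(a < B | letter A a && (0 < e + a))
                   cnt (e + a).-1 n)%N.
Proof.
move=> nB; rewrite /cnt.
have -> : words e n.+1 = [seq a :: s | a <- [seq a <- iota 0 n.+2 | letter A a && (0 < e + a)%N],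
  s <- words (e + a).-1 n] by [].
rewrite size_allpairs_dep sumnE big_map big_filter.
rewrite -(big_mkord (fun a => letter A a && (0 < e + a))
   (fun a => size (words (e + a).-1 n)))%N.
rewrite [RHS](big_cat_nat (leq0n n.+2))//= [X in (_ + X)%N]big1_seq ?addn0//.
move=> a /andP[_]; rewrite mem_index_iota => /andP[na _].
by apply: cnt_eq0; lia.
Qed.

(** First-passage decomposition: a path from height [e + k + 1] steps down by at most 1, so it
    reaches height [k] for the first time by a letter 0 preceded by a path of some length [i] from
    [e] to 0, shifted up by [k + 1]. *)
Lemma cnt_conv e k n :
  cnt (e + k).+1 n = (\sum_(i < n) cnt e i * cnt k (n.-1 - i))%N.
Proof.
elim: n e => [|n IHn] e; first by rewrite big_ord0 cnt0.
rewrite (@cntS (n.+3)%N)// big_ord_recl cnt0 subn0 /=.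
have -> : (\sum_(i < n) cnt e (bump 0 i) * cnt k (n - bump 0 i) =
   \sum_(a < n.+3 | letter A a && (0 < e + a)%N)
      cnt (e + a + k) n)%N.
  transitivity (\sum_(i < n) \sum_(a < n.+3 | letter A a && (0 < e + a))
      cnt (e + a).-1 i * cnt k (n - i.+1))%N.
    apply: eq_bigr => i _; rewrite /bump/= add1n (@cntS n.+3) ?big_distrl//.
    by have := ltn_ord i; lia.
  rewrite exchange_big /=; apply: eq_bigr => a /andP[_ ea].
  have -> : (e + a + k = ((e + a).-1 + k).+1)%N by lia.
  rewrite IHn; apply: eq_bigr => i _.
  by congr (_ * cnt _ _)%N; lia.
have [->|e0] := eqVneq e 0%N.
  rewrite mul1n (bigD1 ord0)//= addn0; congr addn.
  by apply: eq_big => [a|a _]; [rewrite add0n andbT lt0n|congr cnt; lia].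
rewrite mul0n add0n; apply: eq_big => [a|a _]; last by congr cnt; lia.
by congr andb; lia.
Qed.

Lemma cnt_supermul e m n : (cnt e m * cnt 0 n <= cnt e (m + n))%N.
Proof.
elim: m e => [|m IHm] e.
  by rewrite cnt0; case: eqP => [->|_]; rewrite ?mul1n ?mul0n.
rewrite addSn !(@cntS (m + n).+2)//; last by rewrite !ltnS leq_addr.
by rewrite big_distrl; apply: leq_sum => a _; exact: IHm.
Qed.

Lemma cnt_supermul_iter d m q : (cnt 0 d * cnt 0 m ^ q <= cnt 0 (d + q * m))%N.
Proof.
elim: q => [|q IHq]; first by rewrite muln1 mul0n addn0.
rewrite expnSr mulnA mulSn addnCA addnC (leq_trans _ (cnt_supermul _ _ _))//.
by rewrite leq_mul2r IHq orbT.
Qed.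

Lemma card_NC (R : realType) n : (forall i, A i -> (1 <= i)%N) ->
  #|NC R A n| = cnt 0 n.
Proof.
move=> A1; rewrite cardE -(size_map (@partition_code n)); apply: perm_size.
apply: uniq_perm => [||s]; last 2 first.
- exact: uniq_words.
- rewrite mem_words; apply/mapP/andP => [[P]|[/eqP sz gs]].
    rewrite mem_enum => PNC ->; split; last exact: (partition_code_good PNC).
    by rewrite size_min_code.
  have [P PNC Ps] := partition_code_surj R sz gs.
  by exists P; rewrite ?mem_enum.
- rewrite map_inj_in_uniq ?enum_uniq// => P Q; rewrite !mem_enum.
  exact: partition_code_inj.
Qed.

End words.

(** The power lies above its tangent at 1; the induction step loses exactly [n (u - 1)^2]. *)
Lemma bernoulli_ge0 (R : realFieldType) (u : R) n : 0 <= u ->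
  1 + n%:R * (u - 1) <= u ^+ n.
Proof.
move=> u0; elim: n => [|n IHn]; first by rewrite mul0r addr0 expr0.
have := ler_wpM2l u0 IHn; rewrite exprS; apply: le_trans.
rewrite -subr_ge0.
rewrite (_ : _ - _ = n%:R * (u - 1) ^+ 2); first by rewrite mulr_ge0 ?sqr_ge0.
by rewrite -natr1; ring.
Qed.

(** * Lower bounds on truncated generating functions *)

Section generating_function.
Variables (R : realType) (A : set nat).
Hypothesis A_pos : forall i, A i -> (1 <= i)%N.

Definition gf (e M : nat) (x : R) : R := \sum_(0 <= n < M) (cnt A e n)%:R * x ^+ n.

Lemma gf_le e M M' x : 0 <= x -> (M <= M')%N -> gf e M x <= gf e M' x.
Proof.
move=> x0 MM'; rewrite /gf [leRHS](big_cat_nat (leq0n M))//= lerDl.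
by apply: sumr_ge0 => i _; rewrite mulr_ge0 ?exprn_ge0.
Qed.

(** Truncated form of the product formula given by [cnt_conv]: the terms on the left have degree at
    most [(L - 1) + (M - 1) + 1 < L + M], and all coefficients are nonnegative. *)
Lemma gf_conv e k L M x : 0 <= x ->
  x * gf e L x * gf k M x <= gf (e + k).+1 (L + M) x.
Proof.
move=> x0; rewrite /gf.
pose G i n : R := (cnt A e i)%:R * (cnt A k (n.-1 - i))%:R * x ^+ n.
have G0 i n : 0 <= G i n by rewrite !mulr_ge0 ?exprn_ge0.
have -> : \sum_(0 <= n < L + M) (cnt A (e + k).+1 n)%:R * x ^+ n =
    \sum_(0 <= n < L + M) \sum_(0 <= i < L + M | (i < n)%N) G i n.
  apply: eq_big_nat => n /andP[_ nLM].
  rewrite cnt_conv natr_sum mulr_suml -[LHS](big_mkord xpredT (fun i => (cnt A e i * cnt A k (n.-1 - i))%:R * x ^+ n)).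
  rewrite (big_nat_widen _ _ _ _ _ (ltnW nLM)).
  by apply: eq_bigr => i _; rewrite /G natrM.
rewrite (exchange_big_dep_nat xpredT)//=.
rewrite [leRHS](big_cat_nat (leq0n L) (leq_addr _ _))/=.
rewrite -[leLHS]addr0 lerD//; last by apply: sumr_ge0 => i _; exact: sumr_ge0.
rewrite [x * _]mulrC -mulrA mulr_suml; apply: ler_sum_nat => i /andP[_ iL].
rewrite mulr_sumr mulr_sumr.
have iLM : (i.+1 + M <= L + M)%N by rewrite leq_add2r.
rewrite [leRHS](_ : _ = \sum_(i.+1 <= n < L + M) G i n); last first.
  rewrite [LHS](big_cat_nat (leq0n i.+1))//=; last exact: leq_trans (leq_addr _ _) iLM.
  rewrite big1_seq ?add0r; last first.
    move=> n /andP[ni]; rewrite mem_index_iota => /andP[_ ni'].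
    by move: ni; rewrite ltnNge -ltnS ni'.
  by apply: congr_big_nat => // n /andP[-> _].
rewrite (big_cat_nat (leq_addr M _) iLM)/= -[leLHS]addr0 lerD//; last exact: sumr_ge0.
rewrite -{1}[i.+1]add0n [leRHS]big_addn addKn.
rewrite le_eqVlt; apply/orP; left; apply/eqP.
by apply: eq_big_nat => j _; rewrite /G addnS/= addnK exprS exprD; ring.
Qed.

Lemma gf_exp k L x : 0 <= x -> x ^+ k * gf 0 L x ^+ k.+1 <= gf k (k.+1 * L) x.
Proof.
move=> x0; elim: k => [|k IHk]; first by rewrite mul1r mul1n.
rewrite (le_trans _ (@gf_conv 0 k L (k.+1 * L) x x0))//.
have gf0 e M : 0 <= gf e M x.
  by apply: sumr_ge0 => i _; rewrite mulr_ge0 ?exprn_ge0.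
rewrite (le_trans _ (ler_wpM2l _ IHk)) ?mulr_ge0// exprS [_ ^+ k.+2]exprS.
by rewrite le_eqVlt; apply/orP; left; apply/eqP; ring.
Qed.

Lemma gf_first K M x : 0 <= x -> (K <= M)%N ->
  1 + \sum_(0 <= a < K) \1_A a * (x * gf a.-1 M x) <= gf 0 M.+1 x.
Proof.
move=> x0 KM; rewrite [leRHS]big_nat_recl// cnt0 mul1r lerD//.
have -> : \sum_(0 <= n < M) (cnt A 0 n.+1)%:R * x ^+ n.+1 =
    \sum_(0 <= n < M) \sum_(0 <= a < M.+1) \1_A a * (x * ((cnt A a.-1 n)%:R * x ^+ n)).
  apply: eq_big_nat => n /andP[_ nM].
  rewrite (@cntS A M.+1)// natr_sum mulr_suml big_mkord big_mkcond/=.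
  apply: eq_bigr => a _; rewrite indicE add0n /letter.
  have [aA|aA] := boolP ((a : nat) \in A); last first.
    by rewrite orbF; case: (nat_of_ord a) => [|?] /=; rewrite ?mul0r.
  by rewrite orbT (A_pos (set_mem aA)) /= mul1r exprS; ring.
rewrite exchange_big/= [leRHS](big_cat_nat (leq0n K) (leqW KM))/=.
rewrite -[leLHS]addr0 lerD//.
  apply: ler_sum_nat => a _.
  by rewrite /gf !mulr_sumr.
by apply: sumr_ge0 => a _; apply: sumr_ge0 => n _; rewrite !mulr_ge0 ?exprn_ge0// indicE.
Qed.

Variable xi : R.
Hypothesis xi_gt0 : 0 < xi.

(** Write [u = x N / xi] with [N = gf 0 L x]. The first letter [a] contributes at least
    [(x N)^a = xi^a u^a] by [gf_exp], and Bernoulli's inequality bounds this below by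
    [xi^a (1 + a (u - 1))], its tangent at [u = 1]. The truncation order on the right covers every
    [a * L] with [a < K]. *)
Lemma gf_tangent K L x : 0 <= x -> 
  1 + partial_sums A (fun i => xi ^+ i) K +
    (x * gf 0 L x / xi - 1) * partial_sums A (fun i => i%:R * xi ^+ i) K
  <= gf 0 (K * L.+1).+1 x.
Proof.
move=> x0; have KM : (K <= K * L.+1)%N by rewrite leq_pmulr.
apply: le_trans (gf_first x0 KM); rewrite -addrA lerD// /partial_sums /series/= mulr_sumr.
rewrite -big_split/=; apply: ler_sum_nat => a /andP[_ aK].
rewrite indicE; have [aA|] := boolP (a \in A); last by rewrite !mul0r mulr0 addr0.
rewrite !mul1r; have a1 := A_pos (set_mem aA).
have gf0 : 0 <= gf 0 L x.
  by apply: sumr_ge0 => i _; rewrite mulr_ge0 ?exprn_ge0.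
have -> : xi ^+ a + (x * gf 0 L x / xi - 1) * (a%:R * xi ^+ a) =
  xi ^+ a * (1 + a%:R * (x * gf 0 L x / xi - 1)) by ring.
have u0 : 0 <= x * gf 0 L x / xi by rewrite divr_ge0 ?mulr_ge0// ltW.
apply: le_trans (ler_wpM2l _ (bernoulli_ge0 a u0)) _; first by rewrite exprn_ge0 ?ltW.
rewrite -exprMn mulrCA divff ?gt_eqF// mulr1.
rewrite -[in leLHS](prednK a1) exprMn exprS -mulrA ler_wpM2l//.
apply: le_trans (gf_exp a.-1 L x0) _; apply: gf_le => //.
by rewrite prednK// leq_mul// ltnW.
Qed.

Let Z := 1 + sum_over A (fun i => xi ^+ i).
Hypothesis xi_cvg : cvgn (partial_sums A (fun i => xi ^+ i)).
Hypothesis xi_cvg' : cvgn (partial_sums A (fun i => i%:R * xi ^+ i)).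
Hypothesis xi_eq : Z = sum_over A (fun i => i%:R * xi ^+ i).

(** As [K] grows the tangent bound tends to [Z + (u - 1) Z = u Z]: by the equation for [xi], the
    tangent at [xi] to [1 + \sum_(i in A) y^i] passes through the origin. *)
Lemma gf_limit L x C : 0 <= x -> (forall M, gf 0 M x <= C) ->
  x * gf 0 L x / xi * Z <= C.
Proof.
move=> x0 HC.
have H : (fun K => 1 + partial_sums A (fun i => xi ^+ i) K +
    (x * gf 0 L x / xi - 1) * partial_sums A (fun i => i%:R * xi ^+ i) K) @ \oo -->
    Z + (x * gf 0 L x / xi - 1) * Z.
  apply: cvgD; first by apply: cvgD => //; exact: cvg_cst.
  by apply: cvgMr; rewrite [in X in _ --> X]xi_eq.
rewrite (_ : _ * Z = Z + (x * gf 0 L x / xi - 1) * Z); last by ring.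
rewrite -(cvg_lim _ H)//; apply: limr_le; first by apply: cvgP H.
by apply: nearW => K; apply: le_trans (gf_tangent K L x0) (HC _).
Qed.

(** If the partial sums are bounded, their supremum [s] is positive and [gf_limit] yields
    [s * (x Z / xi) <= s], so the factor is at most 1. *)
Lemma gf_radius x C : 0 <= x -> (forall M, gf 0 M x <= C) -> x * Z <= xi.
Proof.
move=> x0 HC; rewrite leNgt; apply/negP => xZ.
pose E := range (fun M => gf 0 M x).
have E0 : E !=set0 by exists (gf 0 0 x); exists 0%N.
have EC C' : (forall M, gf 0 M x <= C') -> ubound E C'.
  by move=> H _ [M _ <-].
have Eb : has_ubound E by exists C; exact: EC.
have q1 : 1 < x * Z / xi by rewrite ltr_pdivlMr// mul1r.
have q0 : 0 < x * Z / xi by exact: lt_trans ltr01 q1.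
have ub M : gf 0 M x <= sup E by apply: ub_le_sup => //; exists M.
have s1 : 0 < sup E.
  apply: lt_le_trans ltr01 (le_trans _ (ub 1%N)).
  by rewrite /gf big_nat1 cnt0 mul1r expr0.
have : sup E <= sup E / (x * Z / xi).
  apply: ge_sup => //; apply: EC => M; rewrite ler_pdivlMr//.
  rewrite [leLHS](_ : _ = x * gf 0 M x / xi * Z); last by ring.
  exact: gf_limit.
by rewrite ler_pdivlMr// ger_pMr// leNgt q1.
Qed.

End generating_function.

(** * Exponential growth and tail bounds *)

Section growth.
Variables (R : realType) (A : set nat) (xi : R).
Hypothesis A_pos : forall i, A i -> (1 <= i)%N.
Hypothesis xi_gt0 : 0 < xi.
Let Z := 1 + sum_over A (fun i => xi ^+ i).
Hypothesis xi_cvg : cvgn (partial_sums A (fun i => xi ^+ i)).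
Hypothesis xi_cvg' : cvgn (partial_sums A (fun i => i%:R * xi ^+ i)).
Hypothesis xi_eq : Z = sum_over A (fun i => i%:R * xi ^+ i).

Lemma partial_sums_nondecreasing (B : set nat) (f : nat -> R) :
  (forall i, 0 <= f i) -> nondecreasing_seq (partial_sums B f).
Proof.
move=> f0; apply: nondecreasing_series => i _ _.
by rewrite mulr_ge0// indicE.
Qed.

Lemma Z_ge1 : 1 <= Z.
Proof.
rewrite lerDl; apply: limr_ge => //; apply: nearW => n.
by apply: sumr_ge0 => i _; rewrite indicE mulr_ge0// exprn_ge0// ltW.
Qed.

Let Z_gt0 : 0 < Z. Proof. exact: lt_le_trans Z_ge1. Qed.
Let t0 := xi / Z.
Let t0_gt0 : 0 < t0. Proof. exact: divr_gt0. Qed.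

(** Otherwise the generating function would be bounded, by a geometric series, at a point beyond
    [t0 = xi / Z], contradicting [gf_radius]. *)
Lemma cnt_rate r : 0 < r < 1 ->
  exists2 m, (0 < m)%N & r ^+ m <= (cnt A 0 m)%:R * t0 ^+ m.
Proof.
move=> /andP[r0 r1]; apply: contrapT => H.
have small m : (cnt A 0 m)%:R * t0 ^+ m <= r ^+ m.
  case: m => [|m]; first by rewrite cnt0 mul1r.
  by rewrite leNgt; apply/negP => /ltW lt; apply: H; exists m.+1.
(* Any factor strictly between 1 and [1 / r] would do: [t0 * c] exceeds [t0] while [r * c < 1]. *)
pose c := 2 / (1 + r).
have r10 : 0 < 1 + r by rewrite addr_gt0.
have c1 : 1 < c by rewrite ltr_pdivlMr// mul1r; lra.
have c0 : 0 < c by exact: lt_trans ltr01 c1.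
have rc0 : 0 <= r * c by rewrite mulr_ge0// ltW.
have rc1 : r * c < 1 by rewrite mulrA ltr_pdivrMr// mul1r; lra.
have : t0 * c * Z <= xi.
  apply: (@gf_radius R A A_pos xi xi_gt0 xi_cvg xi_cvg' xi_eq (t0 * c) (1 - r * c)^-1).
    by rewrite mulr_ge0// ltW.
  move=> M; apply: (@le_trans _ _ (\sum_(0 <= n < M) (r * c) ^+ n)).
    apply: ler_sum_nat => n _; rewrite (exprMn _ t0) (exprMn _ r) mulrA.
    by rewrite ler_wpM2r ?exprn_ge0// ltW.
  have := @geometric_seriesE _ 1 (r * c); rewrite lt_eqF// => /(_ isT) /(congr1 (fun u => u M)).
  rewrite /series/= /geometric/=; under eq_bigr do rewrite mul1r.
  move=> ->; rewrite mul1r ler_pdivrMr ?subr_gt0// mulVf ?gt_eqF ?subr_gt0//.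
  by rewrite gerBl exprn_ge0.
by rewrite mulrAC /t0 divfK ?gt_eqF// leNgt ltr_pMr// c1.
Qed.

(** Let [d] be the least admissible length in the residue class of [n] modulo the [m] of [cnt_rate].
    Then [n = d + q * m], and supermultiplicativity bounds the weight below by [t0^d (r^m)^q]. The
    finitely many factors [t0^d] are absorbed in the constant. *)
Lemma cnt_lower r : 0 < r < 1 ->
  exists2 C, 0 <= C & forall n, (0 < cnt A 0 n)%N ->
    r ^+ n <= C * ((cnt A 0 n)%:R * t0 ^+ n).
Proof.
move=> r01; have [m m0 rm] := cnt_rate r01; have /andP[r0 r1] := r01.
have /fin_all_exists[d dP] (i : 'I_m) : exists d, forall n, (n %% m = i)%N ->
    (0 < cnt A 0 n)%N -> [/\ (0 < cnt A 0 d)%N, (d %% m = i)%N & (d <= n)%N].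
  have [[n [ni n0]]|no] := pselect (exists n, (n %% m = i)%N /\ (0 < cnt A 0 n)%N).
    have ex : exists n, (n %% m == i)%N && (0 < cnt A 0 n)%N by exists n; rewrite ni eqxx.
    case: (ex_minnP ex) => d /andP[/eqP di d0] dmin; exists d => k ki k0; split => //.
    by apply: dmin; rewrite ki eqxx.
  (* In a class without admissible lengths the value 0 is a mere default. *)
  by exists 0%N => n ni n0; exfalso; apply: no; exists n.
have t0d k : 0 < t0 ^- k by rewrite invr_gt0 exprn_gt0.
exists (\sum_(i < m) t0 ^- d i) => [|n n0]; first by apply: sumr_ge0 => i _; exact: ltW.
pose i := Ordinal (ltn_pmod n m0).
have [d0 di dn] := dP i n erefl n0.
have [q nE] : exists q, n = (d i + q * m)%N.
  exists ((n - d i) %/ m)%N; rewrite divnK ?subnKC//.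
  by rewrite -eqn_mod_dvd// di eqxx.
apply: (@le_trans _ _ (t0 ^- d i * ((cnt A 0 n)%:R * t0 ^+ n))); last first.
  rewrite ler_wpM2r ?mulr_ge0 ?exprn_ge0 ?(ltW t0_gt0)//.
  by rewrite (bigD1 i)//= lerDl sumr_ge0// => j _; exact: ltW.
rewrite {2 3}nE exprD [X in _ <= X](_ : _ = (cnt A 0 (d i + q * m))%:R * t0 ^+ (q * m)); last first.
  by field; rewrite expf_neq0// gt_eqF.
apply: (@le_trans _ _ (((cnt A 0 m)%:R * t0 ^+ m) ^+ q)).
  apply: (@le_trans _ _ ((r ^+ m) ^+ q)); last first.
    by rewrite lerXn2r// nnegrE ?exprn_ge0 ?mulr_ge0 ?exprn_ge0 ?(ltW r0) ?(ltW t0_gt0).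
  rewrite -exprM mulnC nE; apply: ler_wiXn2l; rewrite ?(ltW r0) ?(ltW r1)//.
  exact: leq_addl.
rewrite exprMn -exprM (mulnC m) ler_wpM2r ?exprn_ge0 ?(ltW t0_gt0)//.
rewrite -natrX ler_nat; apply: leq_trans (cnt_supermul_iter _ _ _ _).
by rewrite leq_pmull.
Qed.

(** From [expR (- l) >= 1 - l] one gets [expR l <= 1 / (1 - l)], and [(1 - l) (1 + l + 2 l^2) - 1 =
    l^2 (1 - 2 l)] is nonnegative. *)
Lemma expR_le_quad (l : R) : 0 <= l <= 2^-1 -> expR l <= 1 + l + 2 * l ^+ 2.
Proof.
move=> /andP[l0 l1]; have h := expR_ge1Dx (- l).
have l2 : 0 < 1 - l by lra.
have e0 := expR_gt0 l.
have : expR l * (1 - l) <= 1.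
  by rewrite -[leRHS](expRxMexpNx_1 l) ler_wpM2l// ltW.
move=> H; have : (1 - l) * expR l <= (1 - l) * (1 + l + 2 * l ^+ 2).
  rewrite mulrC; apply: le_trans H _.
  rewrite -subr_ge0 [leRHS](_ : _ = l ^+ 2 * (1 - 2 * l)); last by ring.
  by rewrite mulr_ge0 ?sqr_ge0//; lra.
by rewrite ler_pM2l.
Qed.

(** Zero letters are counted as well, so [D] may be the complement of a set of block sizes; upper
    tails for that complement give lower tails for the set itself. *)
Definition entries (D : set nat) n (P : {set {set 'I_n}}) : nat :=
  #|[set x : 'I_n | nth 0%N (partition_code P) x \in D]%SET|.

(** * Chernoff bound for the letters of the code *)

Section tail.
Variables (D : set nat) (p : R).
Hypothesis total1 : forall n, \sum_(0 <= k < n) pi_pmf A xi k <= 1.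
Hypothesis Dp : forall n, \sum_(0 <= k < n) \1_D k * pi_pmf A xi k <= p.
Hypothesis p1 : p <= 1.

Let w := pi_pmf A xi.
Let w_ge0 k : 0 <= w k.
Proof.
by rewrite /w /pi_pmf indicE mulr_ge0// divr_ge0 ?exprn_ge0// ltW.
Qed.

(** The letters of a code sum to [n], so their product of weights is [(xi / Z)^n = t0^n]. The left
    side is thus part of the expansion of an [n]-fold product of one-letter exponential moments, all
    of whose terms are nonnegative. *)
Lemma exp_entries_le n (l : R) : 0 <= l ->
  (\sum_(P in NC R A n) expR (l * (entries D P)%:R)) * t0 ^+ n
  <= expR (n%:R * (p * (expR l - 1))).
Proof.
move=> l0; pose g (k : nat) := w k * expR (l * \1_D k).
have g0 k : 0 <= g k by rewrite mulr_ge0// expR_ge0.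
have el : 0 <= expR l - 1 by rewrite subr_ge0 -expR0 ler_expR.
have gsum : \sum_(k < n.+1) g k <= expR (p * (expR l - 1)).
  apply: le_trans (expR_ge1Dx _).
  have -> : \sum_(k < n.+1) g k = \sum_(0 <= k < n.+1) w k +
     (\sum_(0 <= k < n.+1) \1_D k * w k) * (expR l - 1).
    rewrite mulr_suml -big_split/= big_mkord; apply: eq_bigr => k _.
    rewrite /g indicE; case: (_ \in _); rewrite ?mulr1 ?mulr0 ?expR0 /=; ring.
  by apply: lerD; [exact: total1|exact: ler_wpM2r (Dp _)].
rewrite mulrC; apply: (@le_trans _ _ ((\sum_(k < n.+1) g k) ^+ n)); last first.
  rewrite expRM_natl lerXn2r// nnegrE ?expR_ge0//.
  by apply: sumr_ge0.
rewrite mulrC -[X in _ <= _ ^+ X]card_ord -prodr_const bigA_distr_bigA/= mulr_suml.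
(* Letters of a code are at most [n], so [inord] does not alter them and [F] stays injective. *)
pose F (P : {set {set 'I_n}}) : {ffun 'I_n -> 'I_n.+1} :=
  [ffun x : 'I_n => inord (nth 0%N (partition_code P) x)].
have codeF P x : P \in NC R A n -> F P x = nth 0%N (partition_code P) x :> nat.
  move=> PNC; rewrite ffunE inordK// ltnS nth_min_code.
  by rewrite -[leqRHS]card_ord max_card.
have Finj : {in NC R A n &, injective F}.
  move=> P Q PNC QNC E; apply: (partition_code_inj PNC QNC).
  apply: (@eq_from_nth _ 0%N); rewrite !size_min_code// => i ilt.
  by rewrite -(codeF P (Ordinal ilt))// -(codeF Q (Ordinal ilt))// E.
have -> : \sum_(P in NC R A n) expR (l * (entries D P)%:R) * t0 ^+ n =
    \sum_(P in NC R A n) \prod_(x < n) g (F P x).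
  apply: eq_bigr => P PNC; rewrite big_split/= mulrC; congr (_ * _).
    have [letters _ tot] := goodP _ _ _ (partition_code_good PNC).
    rewrite add0n size_min_code in tot.
    transitivity (\prod_(x < n) (xi ^+ nth 0%N (partition_code P) x / Z)).
      rewrite big_split/= prodr_const card_ord -expr_sum (sum_nth (size_min_code _)).
      by rewrite tot /t0 expr_div_n exprVn.
    apply: eq_bigr => x _; rewrite codeF// /w /pi_pmf indicE.
    have /letters : nth 0%N (partition_code P) x \in partition_code P.
      by rewrite mem_nth// size_min_code.
    move=> /orP[/eqP ->|H]; first by rewrite mem_set ?mulr1//; left.
    by rewrite mem_set ?mulr1//; right; exact: set_mem.
  rewrite -expR_sum -mulr_sumr; congr expR; congr (_ * _).
  rewrite /entries -sum1_card natr_sum big_mkcond/=; apply: eq_bigr => x _.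
  by rewrite finset.inE codeF// indicE; case: (_ \in D).
rewrite -(big_imset (fun f : {ffun 'I_n -> 'I_n.+1} => \prod_(x < n) g (f x)) Finj)/=.
rewrite [leRHS](bigID [in F @: NC R A n]%SET)/= lerDl.
by apply: sumr_ge0 => f _; apply: prodr_ge0.
Qed.

Lemma tail_card n (e : R) : 0 < e <= 1 ->
  #|[set P in NC R A n | n%:R * (p + e) <= (entries D P)%:R]%SET|%:R * t0 ^+ n
  <= expR (- (e ^+ 2 / 8)) ^+ n.
Proof.
(* This is the minimizer of [2 l^2 - l e], whose value there is [- e^2 / 8]; [e <= 1] keeps [l] in
   the range of [expR_le_quad]. *)
move=> /andP[e0 e1]; pose l := e / 4.
have l0 : 0 < l by rewrite divr_gt0.
have t0n : 0 <= t0 ^+ n by rewrite exprn_ge0// ltW.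
have p0 : 0 <= p by have := Dp 0; rewrite big_geq.
have E0 : 0 < expR (l * (n%:R * (p + e))) by exact: expR_gt0.
rewrite -(ler_pM2l E0) [leLHS]mulrA.
apply: (@le_trans _ _ ((\sum_(P in NC R A n) expR (l * (entries D P)%:R)) * t0 ^+ n)).
  rewrite ler_wpM2r// card_set_cond natr_sum mulr_sumr; apply: ler_sum => P _.
  case: (boolP (n%:R * (p + e) <= _)) => [H|_]; last by rewrite mulr0n mulr0 expR_ge0.
  by rewrite mulr1n mulr1 ler_expR ler_pM2l.
apply: le_trans (exp_entries_le n (ltW l0)) _.
rewrite -expRM_natl -expRD ler_expR.
rewrite [leRHS](_ : _ = n%:R * (l * (p + e) - e ^+ 2 / 8)); last by ring.
rewrite ler_wpM2l//.
have : expR l - 1 <= l + 2 * l ^+ 2.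
  by rewrite lerBlDl addrA expR_le_quad// ltW//= /l; lra.
move=> /(ler_wpM2l p0) /le_trans; apply.
have : p * (2 * l ^+ 2) <= 2 * l ^+ 2.
  by rewrite ler_piMl// mulr_ge0// sqr_ge0.
rewrite /l !expr2; nra.
Qed.

(** Half of the exponent [e^2 / 8] pays for the subexponential loss in the number of partitions, via
    [cnt_lower] with [r = expR (- (e^2 / 16))]; the other half remains as the rate. *)
Lemma tail_prob (e : R) : 0 < e <= 1 ->
  exists2 Cq : R * R, 0 <= Cq.1 /\ 0 <= Cq.2 < 1 &
    forall n, (exists P, P \in NC R A n) ->
    unif_prob R (NC R A n) (fun P => n%:R * (p + e) <= (entries D P)%:R)
    <= Cq.1 * Cq.2 ^+ n.
Proof.
move=> e01; have /andP[e0 _] := e01.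
have q01 : 0 < expR (- (e ^+ 2 / 16)) < 1.
  by rewrite expR_gt0/= expR_lt1 oppr_lt0 divr_gt0// exprn_gt0.
have [C C0 HC] := cnt_lower q01; have /andP[q0 q1] := q01.
exists (C, expR (- (e ^+ 2 / 16))); first by rewrite /= q1 (ltW q0).
move=> n [P PNC] /=; rewrite /unif_prob.
have N0 : (0 < #|NC R A n|)%N by apply/card_gt0P; exists P.
have := HC n; rewrite -(card_NC R n A_pos) => /(_ N0) {}HC.
have N0' : 0 < (#|NC R A n|)%:R :> R by rewrite ltr0n.
have t0n : 0 < t0 ^+ n by rewrite exprn_gt0.
rewrite ler_pdivrMr// -(ler_pM2r t0n) (le_trans (tail_card n e01))//.
rewrite (_ : _ / 8 = e ^+ 2 / 16 + e ^+ 2 / 16); last by field.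
rewrite opprD expRD exprMn mulrC.
rewrite [leRHS](_ : _ = expR (- (e ^+ 2 / 16)) ^+ n *
   (C * (#|NC R A n|%:R * t0 ^+ n))); last by ring.
by rewrite ler_pM2l// exprn_gt0.
Qed.

End tail.
End growth.

(** * Limits *)

Section finite_averages.
Variables (R : realType) (T : finType) (S : {set T}).

Lemma unif_prob_mean (E : pred T) : unif_prob R S E = unif_mean S (fun x => (E x)%:R).
Proof. by rewrite /unif_prob /unif_mean card_set_cond natr_sum. Qed.

Lemma unif_probU (E1 E2 E : pred T) : {in S, forall x, E x -> E1 x || E2 x} ->
  unif_prob R S E <= unif_prob R S E1 + unif_prob R S E2.
Proof.
move=> sub; rewrite !unif_prob_mean /unif_mean -mulrDl -big_split/=.
rewrite ler_wpM2r ?invr_ge0//; apply: ler_sum => x xS.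
by case: (boolP (E x)) => [/(sub _ xS)|_]; case: (E1 x); case: (E2 x);
  rewrite ?addr0 ?add0r ?addr_ge0 ?lerDl.
Qed.

Lemma unif_mean_dist (X : T -> R) (E : pred T) l e : S != finset.set0 -> 0 <= e ->
  {in S, forall x, ~~ E x -> `|X x - l| <= e} -> {in S, forall x, `|X x - l| <= 1} ->
  `|unif_mean S X - l| <= e + unif_prob R S E.
Proof.
move=> S0 e0 good_ bad; have N0 : 0 < #|S|%:R :> R by rewrite ltr0n card_gt0.
have cst c : (\sum_(x in S) c) / #|S|%:R = c :> R.
  by rewrite sumr_const -[c *+ _]mulr_natr mulfK// gt_eqF.
rewrite unif_prob_mean /unif_mean -(cst l) -(cst e) -mulrDl -mulrBl -sumrB -big_split/=.
rewrite normrM [X in _ * X]ger0_norm ?invr_ge0// ler_wpM2r ?invr_ge0//.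
apply: le_trans (ler_norm_sum _ _ _) _; apply: ler_sum => x xS.
have [Ex|Ex] := boolP (E x); last by rewrite addr0; exact: good_.
by rewrite (le_trans (bad x xS))// lerDr.
Qed.

End finite_averages.

(** The numerator [(z - a) b - a (N - b)] is at most [2 e b] in absolute value, and [N >= b / 2]. *)
Lemma ratio_dist (R : realType) (z N a b e : R) : 0 <= a <= b -> 0 < b ->
  `|z - a| <= e -> `|N - b| <= e -> e <= b / 2 -> `|z / N - a / b| <= 4 * e / b.
Proof.
move=> /andP[a0 ab] b0 za Nb eb.
have Nb2 : b / 2 <= N by move: Nb; rewrite ler_norml => /andP[]; lra.
have N0 : 0 < N by rewrite (lt_le_trans _ Nb2)// divr_gt0.
have -> : z / N - a / b = ((z - a) * b - a * (N - b)) / (N * b).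
  by field; rewrite !gt_eqF.
have Nb0 : 0 < N * b by rewrite mulr_gt0.
rewrite normrM normfV (gtr0_norm Nb0) ler_pdivrMr//.
have -> : 4 * e / b * (N * b) = 4 * e * N by field; rewrite gt_eqF.
have e0 : 0 <= e by exact: le_trans za.
apply: (@le_trans _ _ (e * b + b * e)).
  apply: le_trans (ler_normB _ _) _; rewrite !normrM (ger0_norm a0) (gtr0_norm b0).
  by apply: lerD; [exact: ler_wpM2r (ltW b0) _ _ za|exact: ler_pM].
nra.
Qed.

Lemma cvg_along (R : realType) (A : set nat) (f : nat -> R) l :
  (forall e, 0 < e -> \forall n \near \oo, (0 < n)%N ->
     (exists P, P \in NC R A n) -> `|f n - l| <= e) ->
  f n @[n --> along R A] --> l.
Proof.
move=> H; have along_filter : Filter (along R A) by exact: within_filter.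
apply/cvgrPdist_le => e /H; apply: filterS => n Hn [n0 nNC].
by rewrite distrC; exact: Hn.
Qed.

Section conclusion.
Variables (R : realType) (A : set nat) (xi : R).
Hypothesis A_neq0 : A !=set0.
Hypothesis A_pos : forall i, A i -> (1 <= i)%N.
Hypothesis xi_gt0 : 0 < xi.
Let Z := 1 + sum_over A (fun i => xi ^+ i).
Hypothesis xi_cvg : cvgn (partial_sums A (fun i => xi ^+ i)).
Hypothesis xi_cvg' : cvgn (partial_sums A (fun i => i%:R * xi ^+ i)).
Hypothesis xi_eq : Z = sum_over A (fun i => i%:R * xi ^+ i).

Let Z_ge1 : 1 <= Z. Proof. exact: Z_ge1. Qed.
Let Z_gt0 : 0 < Z. Proof. exact: lt_le_trans Z_ge1. Qed.
Let w := pi_pmf A xi.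

Let w_ge0 k : 0 <= w k.
Proof. by rewrite /w /pi_pmf indicE mulr_ge0// divr_ge0 ?exprn_ge0// ltW. Qed.

Let A0 : 0%N \notin A.
Proof. by apply/negP => /set_mem /A_pos. Qed.

Let w0 : w 0 = Z^-1.
Proof. by rewrite /w /pi_pmf expr0 mul1r indicE mem_set ?mulr1//; left. Qed.

Let wS k : (0 < k)%N -> w k = (\1_A k * xi ^+ k) / Z.
Proof.
move=> k0; rewrite /w /pi_pmf !indicE.
have -> : (k \in [set 0%N] `|` A) = (k \in A).
  by rewrite in_setU memNset//= => kz; rewrite kz in k0.
by rewrite mulrAC [xi ^+ k * _]mulrC.
Qed.

Let total n : \sum_(0 <= k < n.+1) w k = (1 + partial_sums A (fun i => xi ^+ i) n.+1) / Z.
Proof.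
rewrite /partial_sums /series/= mulrDl mul1r mulr_suml !big_nat_recl//.
rewrite w0 indicE (negbTE A0) !mul0r add0r; congr (_ + _).
by apply: eq_bigr => k _; rewrite wS.
Qed.

Let total_le1 n : \sum_(0 <= k < n) w k <= 1.
Proof.
case: n => [|n]; first by rewrite big_geq.
rewrite total ler_pdivrMr// mul1r lerD2l.
apply: nondecreasing_cvgn_le => //.
by apply: partial_sums_nondecreasing => i; rewrite exprn_ge0// ltW.
Qed.

Let nd (C : set nat) : nondecreasing_seq (partial_sums C w).
Proof. exact: partial_sums_nondecreasing. Qed.

Let part_le_total (C : set nat) n : partial_sums C w n <= \sum_(0 <= k < n) w k.
Proof.
apply: ler_sum => k _; rewrite indicE.
by case: (_ \in _); rewrite ?mul1r ?mul0r.
Qed.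

Let part_cvg (C : set nat) : cvgn (partial_sums C w).
Proof.
apply: nondecreasing_is_cvgn; first exact: nd.
exists 1 => _ [n _ <-]; exact: le_trans (part_le_total _ _) (total_le1 _).
Qed.

Let part_le (C : set nat) n :
  \sum_(0 <= k < n) \1_C k * w k <= pi_measure A xi C.
Proof. by apply: (@nondecreasing_cvgn_le _ (partial_sums C w)). Qed.

Let measure_ge0 (C : set nat) : 0 <= pi_measure A xi C.
Proof. by have := part_le C 0; rewrite big_geq. Qed.

Let measure_le1 (C : set nat) : pi_measure A xi C <= 1.
Proof.
apply: limr_le; first exact: part_cvg.
by apply: nearW => n; exact: le_trans (part_le_total _ _) (total_le1 _).
Qed.

Let partC_le (C : set nat) n :
  \sum_(0 <= k < n) \1_(~` C) k * w k <= 1 - pi_measure A xi C.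
Proof.
rewrite lerBrDl -lerBrDr; apply: limr_le; first exact: part_cvg.
near=> N; rewrite lerBrDr.
apply: (@le_trans _ _ (partial_sums C w N + partial_sums (~` C) w N)).
  by rewrite lerD2l; apply: nd; near: N; exists n.
rewrite /partial_sums /series/= -big_split/=.
rewrite (eq_bigr w) => [|k _]; first exact: total_le1.
rewrite !indicE in_setC.
by case: (k \in C); rewrite ?mul1r ?mul0r ?addr0 ?add0r.
Unshelve. all: by end_near. Qed.

Lemma pi_measure_set1 k : pi_measure A xi [set k] = pi_pmf A xi k.
Proof.
apply: (@lim_near_cst R) => //; near=> n.
have kn : (k < n)%N by near: n; exists k.+1.
rewrite /partial_sums /series/= (bigD1_seq k) ?mem_index_iota ?iota_uniq//=.
rewrite indicE mem_set// mul1r big1 ?addr0// => i ik.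
by rewrite indicE memNset ?mul0r// => /= E; rewrite E eqxx in ik.
Unshelve. all: by end_near. Qed.

Lemma pi_measure_pos : pi_measure A xi [set k | (1 <= k)%N] = 1 - pi_pmf A xi 0.
Proof.
have -> : 1 - pi_pmf A xi 0 = sum_over A (fun i => xi ^+ i) / Z.
  by rewrite -/w w0 /Z; field; rewrite gt_eqF.
have H : partial_sums A (fun i => xi ^+ i) n / Z @[n --> \oo] -->
    sum_over A (fun i => xi ^+ i) / Z by apply: cvgMl.
rewrite -(cvg_lim _ H)//; congr (lim (_ @ \oo)); apply/funext => n.
rewrite /partial_sums /series/= mulr_suml; apply: eq_bigr => -[|k] _.
  by rewrite !indicE (negbTE A0) memNset ?mul0r.
by rewrite [\1__ _]indicE mem_set// mul1r; exact: wS.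
Qed.

Lemma pi_pmf0_lt1 : pi_pmf A xi 0 < 1.
Proof.
rewrite -/w w0 invf_lt1// ltrDl; have [i Ai] := A_neq0.
have : 0 < partial_sums A (fun i => xi ^+ i) i.+1.
  rewrite /partial_sums /series/= big_nat_recr//= ltr_wpDl//.
    by apply: sumr_ge0 => j _; rewrite indicE mulr_ge0// exprn_ge0// ltW.
  by rewrite indicE mem_set// mul1r exprn_gt0.
move=> /lt_le_trans; apply; apply: nondecreasing_cvgn_le => //.
by apply: partial_sums_nondecreasing => j; rewrite exprn_ge0// ltW.
Qed.

(** * Concentration of block counts *)

Section concentration.
Variable C : set nat.
Hypothesis C_pos : forall i, C i -> (1 <= i)%N.
Let p := pi_measure A xi C.

Lemma zeta_entries n P : P \in NC R A n -> zeta C P = entries C P.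
Proof. by move=> /NCP[partP _ _]; rewrite zeta_code. Qed.

Lemma entries_setC n (P : {set {set 'I_n}}) : (entries C P + entries (~` C) P)%N = n.
Proof.
rewrite /entries -[RHS]card_ord -[RHS](cardsC [set x : 'I_n | nth 0%N (partition_code P) x \in C]%SET).
by congr addn; apply: eq_card => x; rewrite !finset.inE in_setC.
Qed.

Lemma zeta_bounds n P : P \in NC R A n -> 0 <= (zeta C P)%:R / (n%:R : R) <= 1.
Proof.
move=> PNC; rewrite divr_ge0//=; case: n P PNC => [|n] P PNC; first by rewrite invr0 mulr0.
by rewrite ler_pdivrMr// mul1r ler_nat (zeta_entries PNC) -[leqRHS](entries_setC P) leq_addr.
Qed.

Lemma zeta_dist1 n P : P \in NC R A n -> `|(zeta C P)%:R / n%:R - p| <= 1.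
Proof.
move=> /zeta_bounds/andP[z0 z1]; rewrite ler_norml.
by have := measure_ge0 C; have := measure_le1 C; rewrite -/p; lra.
Qed.

(** A count that is too large is an upper deviation for [C]; one that is too small is an upper
    deviation for the complement of [C], whose mass is at most [1 - p]. Each has exponentially small
    probability. Replacing [e] by [Num.min e 1] meets the range of [tail_prob]. *)
Lemma zeta_concentration e d : 0 < e -> 0 < d ->
  \forall n \near \oo, (0 < n)%N -> (exists P, P \in NC R A n) ->
    unif_prob R (NC R A n) (fun P => e < `|(zeta C P)%:R / n%:R - p|) <= d.
Proof.
move=> e0 d0; pose e' := Num.min e 1.
have e'01 : 0 < e' <= 1 by rewrite lt_min e0 ltr01 ge_min lexx orbT.
have [[C1 q1] /= [C10 /andP[q10 q11]] H1] := tail_prob A_pos xi_gt0 xi_cvg xi_cvg' xi_eq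
  total_le1 (part_le C) (measure_le1 C) e'01.
have pC1 : 1 - p <= 1 by rewrite gerBl measure_ge0.
have [[C2 q2] /= [C20 /andP[q20 q21]] H2] := tail_prob A_pos xi_gt0 xi_cvg xi_cvg' xi_eq
  total_le1 (partC_le C) pC1 e'01.
have geo K q : 0 <= K -> 0 <= q -> q < 1 -> \forall n \near \oo, K * q ^+ n <= d / 2.
  move=> K0 q0 q_1; have := @cvg_geometric R K q; rewrite ger0_norm// => /(_ q_1).
  move=> /cvgrPdist_le/(_ (d / 2)); rewrite divr_gt0// => /(_ isT).
  apply: filterS => n; rewrite sub0r normrN ger0_norm//.
  by rewrite /geometric/= mulr_ge0// exprn_ge0.
near=> n => n0 nNC.
apply: (@le_trans _ _ (d / 2 + d / 2)); last by rewrite -splitr.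
have n0' : 0 < n%:R :> R by rewrite ltr0n.
apply: (@le_trans _ _
  (unif_prob R (NC R A n) (fun P => n%:R * (p + e') <= (entries C P)%:R) +
   unif_prob R (NC R A n) (fun P => n%:R * (1 - p + e') <= (entries (~` C) P)%:R))).
  apply: unif_probU => P PNC; rewrite (zeta_entries PNC).
  have -> : (entries (~` C) P)%:R = n%:R - (entries C P)%:R :> R.
    by apply/esym/eqP; rewrite subr_eq -natrD addnC entries_setC.
  have e'e : e' <= e by rewrite ge_min lexx.
  have : (entries C P)%:R = n%:R * ((entries C P)%:R / n%:R) :> R.
    by rewrite mulrC divfK// gt_eqF.
  move: (_ / n%:R) => y ->; rewrite (_ : n%:R - _ = n%:R * (1 - y)); last by ring.
  rewrite !ler_pM2l//.
  have [py|yp] := leP p y.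
    by rewrite ger0_norm ?subr_ge0// => H; apply/orP; left; lra.
  by rewrite ltr0_norm ?subr_lt0// => H; apply/orP; right; lra.
apply: lerD.
  by apply: le_trans (H1 n nNC) _; near: n; exact: geo.
by apply: le_trans (H2 n nNC) _; near: n; exact: geo.
Unshelve. all: by end_near. Qed.

(** The proportion and its limit both lie between 0 and 1, so an exceptional event of probability at
    most [e / 2] shifts the mean by at most [e / 2]. *)
Lemma zeta_mean e : 0 < e ->
  \forall n \near \oo, (0 < n)%N -> (exists P, P \in NC R A n) ->
    `|unif_mean (NC R A n) (fun P => (zeta C P)%:R : R) / n%:R - p| <= e.
Proof.
move=> e0; have e2 : 0 < e / 2 by rewrite divr_gt0.
apply: filterS (zeta_concentration e2 e2) => n H n0 nNC; have {}H := H n0 nNC.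
have -> : unif_mean (NC R A n) (fun P => (zeta C P)%:R : R) / n%:R =
    unif_mean (NC R A n) (fun P => (zeta C P)%:R / n%:R).
  by rewrite /unif_mean mulrAC mulr_suml.
apply: (@le_trans _ _ (e / 2 + e / 2)); last by rewrite -splitr.
apply: le_trans (lerD (lexx _) H).
apply: unif_mean_dist => [||P PNC|P]; rewrite ?(ltW e2)//.
- by apply/finset.set0Pn; case: nNC => P PNC; exists P.
- by rewrite -leNgt.
- exact: zeta_dist1.
Qed.

End concentration.

Lemma first_block_mean k n : (0 < n)%N ->
  unif_prob R (NC R A n) (fun P => first_block_size P == k) =
  k%:R * (unif_mean (NC R A n) (fun P => (zeta [set k] P)%:R : R) / n%:R).
Proof.
case: n => // n _; have := card_first_block R A n k.
rewrite -big_distrr/= => /(congr1 (fun j : nat => j%:R : R)).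
rewrite !natrM natr_sum => H; rewrite /unif_prob /unif_mean !mulrA -H.
by rewrite [RHS]mulrAC [n.+1%:R * _]mulrC mulfK.
Qed.

Lemma first_block_cvg k : (1 <= k)%N ->
  unif_prob R (NC R A n) (fun P => first_block_size P == k)
    @[n --> along R A] --> k%:R * pi_pmf A xi k.
Proof.
move=> k1; have k0 : 0 < k%:R :> R by rewrite ltr0n.
apply: cvg_along => e e0; have ek : 0 < e / k%:R by rewrite divr_gt0.
have kpos i : [set k] i -> (1 <= i)%N by move=> ->.
apply: filterS (zeta_mean kpos ek) => n H n0 nNC.
rewrite first_block_mean// -pi_measure_set1 -mulrBr normrM gtr0_norm//.
by rewrite mulrC -ler_pdivlMr// H.
Qed.

(** Expresses the total number of blocks as a [zeta], so that concentration also applies to the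
    denominator in the law of a random block. *)
Lemma card_zeta n P : P \in NC R A n -> #|P| = zeta [set k | (1 <= k)%N] P.
Proof.
move=> /NCP[/and3P[_ _ P0] _ _]; apply: eq_card => B.
rewrite finset.inE; case: (boolP (B \in P)) => //= BP.
apply/esym/mem_set => /=; rewrite card_gt0.
by apply: contraNneq P0 => <-.
Qed.

Lemma random_block_cvg k : (1 <= k)%N ->
  unif_mean (NC R A n) (fun P => unif_prob R P (fun B => #|B| == k))
    @[n --> along R A] --> pi_pmf A xi k / (1 - pi_pmf A xi 0).
Proof.
move=> k1; set b := 1 - _; apply: cvg_along => e e0.
have b0 : 0 < b by rewrite subr_gt0 pi_pmf0_lt1.
have kpos i : [set k] i -> (1 <= i)%N by move=> ->.
have ab : 0 <= pi_pmf A xi k <= b.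
  rewrite w_ge0 /b lerBrDr addrC; apply: le_trans (total_le1 k.+1).
  rewrite big_nat_recl// lerD2l -/w.
  case: k k1 kpos => // k _ _; rewrite big_nat_recr//= lerDr.
  exact: sumr_ge0.
(* The bound [b / 2] is the one [ratio_dist] asks for, and [e * b / 8] makes its error [4 h / b] at
   most [e / 2]; the two exceptional events cost [e / 4] each. *)
pose h := Num.min (b / 2) (e * b / 8).
have h0 : 0 < h by rewrite lt_min !divr_gt0// mulr_gt0.
have e4 : 0 < e / 4 by rewrite divr_gt0.
have npos i : [set k | (1 <= k)%N] i -> (1 <= i)%N by [].
apply: filterS2 (zeta_concentration kpos h0 e4) (zeta_concentration npos h0 e4).
move=> n Hk Hpos n0 nNC; have {}Hk := Hk n0 nNC; have {}Hpos := Hpos n0 nNC.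
pose bad (C : set nat) (P : {set {set 'I_n}}) := h < `|(zeta C P)%:R / n%:R - pi_measure A xi C|.
have n0' : n%:R != 0 :> R by rewrite pnatr_eq0 -lt0n.
have ratioE P : P \in NC R A n -> unif_prob R P (fun B => #|B| == k) =
    ((zeta [set k] P)%:R / n%:R) / ((zeta [set k | (1 <= k)%N] P)%:R / n%:R).
  move=> PNC; rewrite /unif_prob (card_zeta PNC).
  have -> : #|[set B in P | #|B| == k]%SET| = zeta [set k] P.
    apply: eq_card => B; rewrite !finset.inE; congr andb.
    by apply/eqP/idP => [/mem_set//|/set_mem].
  by rewrite invfM invrK mulrACA mulVf// mulr1.
apply: (@le_trans _ _ (e / 2 + (e / 4 + e / 4))); last by lra.
apply: (@le_trans _ _ (e / 2 + unif_prob R (NC R A n)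
   (fun P => bad [set k] P || bad [set k | (1 <= k)%N] P))).
  apply: unif_mean_dist => [||P PNC|P PNC].
  - by apply/finset.set0Pn; case: nNC => P PNC; exists P.
  - by rewrite divr_ge0// ltW.
  - rewrite negb_or /bad -!leNgt ratioE// pi_measure_set1 pi_measure_pos => /andP[z1 z2].
    apply: le_trans (ratio_dist ab b0 z1 z2 _) _; first by rewrite ge_min lexx.
    rewrite ler_pdivrMr//; have : h <= e * b / 8 by rewrite ge_min lexx orbT.
    lra.
  have r01 : 0 <= unif_prob R P (fun B => #|B| == k) <= 1.
    rewrite /unif_prob divr_ge0//=; have [->|P0] := eqVneq #|P| 0%N; first by rewrite invr0 mulr0.
    rewrite ler_pdivrMr ?ltr0n ?lt0n// mul1r ler_nat.
    by apply/subset_leq_card/fintype.subsetP => B; rewrite finset.inE => /andP[].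
  have s01 : 0 <= pi_pmf A xi k / b <= 1.
    by case/andP: ab => a0 ab'; rewrite divr_ge0 ?(ltW b0)//= ler_pdivrMr// mul1r.
  by rewrite ler_norml; lra.
rewrite lerD2l; apply: (@le_trans _ _ (unif_prob R (NC R A n) (bad [set k]) +
    unif_prob R (NC R A n) (bad [set k | (1 <= k)%N]))).
  by apply: unif_probU => P _.
exact: lerD.
Qed.

Lemma zeta_cvg (C : set nat) : (forall i, C i -> (1 <= i)%N) ->
  (forall eps : R, 0 < eps ->
     unif_prob R (NC R A n)
       (fun P => eps < `|(zeta C P)%:R / n%:R - pi_measure A xi C|)
       @[n --> along R A] --> (0 : R)) /\
  (unif_mean (NC R A n) (fun P => (zeta C P)%:R : R) / n%:R
     @[n --> along R A] --> pi_measure A xi C).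
Proof.
move=> C_pos; split => [eps eps0|]; apply: cvg_along => e e0; last exact: zeta_mean.
apply: filterS (zeta_concentration C_pos eps0 e0) => n H n0 nNC.
by rewrite subr0 ger0_norm ?H// divr_ge0.
Qed.

End conclusion.

Theorem theorem1 (R : realType) (A : set nat)
    (A_neq0 : A !=set0)
    (A_pos : forall i, A i -> (1 <= i)%N)
    (A_neq1 : A <> [set 1%N])
    (xi : R) (xi_gt0 : 0 < xi)
    (xi_cvg : cvgn (partial_sums A (fun i => xi ^+ i)))
    (xi_cvg' : cvgn (partial_sums A (fun i => i%:R * xi ^+ i)))
    (xi_eq : 1 + sum_over A (fun i => xi ^+ i)
             = sum_over A (fun i => i%:R * xi ^+ i)) :
  [/\ (* (i) *)
      forall k : nat, (1 <= k)%N ->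
        unif_prob R (NC R A n) (fun P => first_block_size P == k)
          @[n --> along R A] --> k%:R * pi_pmf A xi k,
      (* (ii): first a uniform partition P, then a uniform block of P *)
      forall k : nat, (1 <= k)%N ->
        unif_mean (NC R A n) (fun P => unif_prob R P (fun B => #|B| == k))
          @[n --> along R A] --> pi_pmf A xi k / (1 - pi_pmf A xi 0)
    & (* (iii) *)
      forall C : set nat, C !=set0 -> (forall i, C i -> (1 <= i)%N) ->
        (forall eps : R, 0 < eps ->
           unif_prob R (NC R A n)
             (fun P => eps < `|(zeta C P)%:R / n%:R - pi_measure A xi C|)
             @[n --> along R A] --> (0 : R)) /\
        (unif_mean (NC R A n) (fun P => (zeta C P)%:R : R) / n%:R
           @[n --> along R A] --> pi_measure A xi C)].
Proof.
split=> [k k1|k k1|C _ C_pos].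
- exact: first_block_cvg.
- exact: random_block_cvg.
- exact: zeta_cvg.
Qed.
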